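(* Let $H$ be a Hopf algebra over a field $\Bbbk$ with restricted (finite) dual $H^\circ$, and let $\mathfrak{g}\subseteq(H^\circ)^+$ be a finite-dimensional vector subspace. Define $\mathfrak{X}_H:=H\otimes\mathfrak{g}$, with left $H$-action by multiplication on the first factor, and $\mathscr{L}\colon\mathfrak{X}_H\to\mathrm{End}_\Bbbk(H)$, $\mathscr{L}_{h\otimes\chi}(g):=hg_1\chi(g_2)$ for $h,g\in H$, $\chi\in\mathfrak{g}$. Then the following are equivalent: (i) $(\mathfrak{X}_H,\mathscr{L})$ is a first order vector field calculus on $H$ (i.e. there is a right $H$-action making $\mathfrak{X}_H$ an $H$-bimodule such that $(\mathfrak{X}_H,\mathscr{L})$ is a first order vector field calculus); (ii) $\mathfrak{g}$ is a quantum tangent space. In this case $(\mathfrak{X}_H,\mathscr{L})$ is left $H$-covariant via the left $H$-coaction $\mathfrak{X}_H\to H\otimes\mathfrak{X}_H$, $h\otimes\chi\mapsto h_1\otimes h_2\otimes\chi$.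
   Context: $H^\circ$ is the finite (Sweedler) dual Hopf algebra of $H$, with comultiplication $\Delta$ satisfying $\Delta(u)(h\otimes g)=u(hg)$ and unit $\varepsilon$ (the counit of $H$); $(H^\circ)^+=\{u\in H^\circ\mid u(1)=0\}$ is the kernel of the counit of $H^\circ$. Sweedler notation $\Delta(g)=g_1\otimes g_2$ is used. A subspace $\mathfrak{g}\subset(H^\circ)^+$ is a quantum tangent space if it is finite-dimensional and $\Delta(\mathfrak{g})\subset\mathfrak{g}\otimes\varepsilon+H^\circ\otimes\mathfrak{g}$. A first order vector field calculus (FOVC) on an associative unital algebra $A$ is a pair $(\mathfrak{X},\mathscr{L})$ where $\mathfrak{X}$ is an $A$-bimodule and $\mathscr{L}\colon\mathfrak{X}\to\mathrm{End}_\Bbbk(A)$ is $\Bbbk$-linear, injective, left $A$-linear ($\mathscr{L}_{a\cdot X}(b)=a\mathscr{L}_X(b)$) and satisfies $\mathscr{L}_X(ab)=\mathscr{L}_X(a)b+\mathscr{L}_{X\cdot a}(b)$. A FOVC on $H$ is left $H$-covariant if $\mathfrak{X}$ is a left $H$-covariant $H$-bimodule, i.e. carries a left $H$-coaction ${}_{\mathfrak{X}}\Delta$ with ${}_{\mathfrak{X}}\Delta(h\cdot X\cdot h')=\Delta(h)\,{}_{\mathfrak{X}}\Delta(X)\,\Delta(h')$, and $\mathfrak{X}\otimes H\to H$, $X\otimes h\mapsto\mathscr{L}_X(h)$, is left $H$-colinear for the diagonal left coaction on $\mathfrak{X}\otimes H$ and the coaction $\Delta$ on $H$. *)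

(* Defs.v *)
From HB Require Import structures.
From mathcomp Require Import all_boot all_order all_algebra.
From mathcomp Require Import boolp functions.

Set Implicit Arguments.
Unset Strict Implicit.
Unset Printing Implicit Defensive.

Import GRing.Theory.
Local Open Scope ring_scope.
Local Open Scope quotient_scope.

Reserved Notation "U ⊗ V" (at level 38, left associativity).
Reserved Notation "u ⊗t v" (at level 38, left associativity).

(* Tensor product of k-vector spaces: finite formal sums of pairs (u, v)    *)
(* modulo the congruence generated by bilinearity; the universal property   *)
(* is tliftE, tlift_linear and tlift_unique below.                          *)
Section Tensor.
Variables (k : fieldType) (U V : lmodType k).
Implicit Types s t : seq (U * V).

Inductive tens_rel : seq (U * V) -> seq (U * V) -> Prop :=
| TensRefl s : tens_rel s s
| TensSym s t : tens_rel s t -> tens_rel t s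
| TensTrans s t r : tens_rel s t -> tens_rel t r -> tens_rel s r
| TensCat s s' t t' :
    tens_rel s s' -> tens_rel t t' -> tens_rel (s ++ t) (s' ++ t')
| TensComm s t : tens_rel (s ++ t) (t ++ s)
| TensDl u u' v : tens_rel [:: (u + u', v)] [:: (u, v); (u', v)]
| TensDr u v v' : tens_rel [:: (u, v + v')] [:: (u, v); (u, v')]
| TensZ (a : k) u v : tens_rel [:: (a *: u, v)] [:: (u, a *: v)]
| Tens0 v : tens_rel [:: (0, v)] [::].

Definition tens_eq s t : bool := `[< tens_rel s t >].

Lemma tens_eq_refl : reflexive tens_eq.
Proof. by move=> s; apply/asboolP; exact: TensRefl. Qed.
Lemma tens_eq_sym : symmetric tens_eq.
Proof.
by move=> s t; apply/asboolP/asboolP; exact: TensSym.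
Qed.
Lemma tens_eq_trans : transitive tens_eq.
Proof.
by move=> t s r /asboolP st /asboolP tr; apply/asboolP; exact: TensTrans st tr.
Qed.

Canonical tens_equiv := EquivRel tens_eq tens_eq_refl tens_eq_sym tens_eq_trans.
Canonical tens_equiv_direct := defaultEncModRel tens_eq.

Definition tens := {eq_quot tens_eq}.
HB.instance Definition _ := Quotient.on tens.
HB.instance Definition _ := Choice.on tens.
HB.instance Definition _ : EqQuotient _ tens_eq tens := EqQuotient.on tens.

Lemma tens_piP s t : tens_rel s t <-> \pi_tens s = \pi_tens t.
Proof.
split=> [st|/eqmodP/asboolP//].
by apply/eqmodP/asboolP.
Qed.

Definition tens_zero : tens := \pi_tens [::].
Definition tens_add (x y : tens) : tens := \pi_tens (repr x ++ repr y).
Definition tens_scale_seq (a : k) s := [seq (a *: p.1, p.2) | p <- s].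
Definition tens_scale (a : k) (x : tens) : tens :=
  \pi_tens (tens_scale_seq a (repr x)).

Lemma tens_repr s : tens_rel (repr (\pi_tens s)) s.
Proof. by apply/tens_piP; rewrite reprK. Qed.

Lemma tens_addE s t : tens_add (\pi_tens s) (\pi_tens t) = \pi_tens (s ++ t).
Proof. by apply/tens_piP; apply: TensCat; apply: tens_repr. Qed.

Lemma tens_scale_rel a s t :
  tens_rel s t -> tens_rel (tens_scale_seq a s) (tens_scale_seq a t).
Proof.
elim=> {s t} /=.
- by move=> s; exact: TensRefl.
- by move=> s t _ st; exact: TensSym st.
- by move=> s t r _ st _ tr; exact: TensTrans st tr.
- by move=> s s' t t' _ ? _ ?; rewrite /tens_scale_seq !map_cat; exact: TensCat.
- by move=> s t; rewrite /tens_scale_seq !map_cat; exact: TensComm.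
- by move=> u u' v; rewrite scalerDr; exact: TensDl.
- by move=> u v v'; exact: TensDr.
- by move=> b u v; rewrite scalerA mulrC -scalerA; exact: TensZ.
- by move=> v; rewrite scaler0; exact: Tens0.
Qed.

Lemma tens_scaleE a s :
  tens_scale a (\pi_tens s) = \pi_tens (tens_scale_seq a s).
Proof. by apply/tens_piP; apply: tens_scale_rel; apply: tens_repr. Qed.

Lemma tens_addA : associative tens_add.
Proof.
elim/quotW=> s; elim/quotW=> t; elim/quotW=> r.
by rewrite (tens_addE t r) (tens_addE s t) (tens_addE s) (tens_addE _ r) catA.
Qed.
Lemma tens_addC : commutative tens_add.
Proof.
elim/quotW=> s; elim/quotW=> t; rewrite (tens_addE s t) (tens_addE t s).
by apply/tens_piP; exact: TensComm.
Qed.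
Lemma tens_add0 : left_id tens_zero tens_add.
Proof. by elim/quotW=> s; rewrite /tens_zero (tens_addE [::]). Qed.

HB.instance Definition _ :=
  GRing.isNmodule.Build tens tens_addA tens_addC tens_add0.

Lemma tens_piD s t : \pi_tens (s ++ t) = \pi_tens s + \pi_tens t :> tens.
Proof. exact/esym/tens_addE. Qed.

Lemma tens_scaleA a b x : tens_scale a (tens_scale b x) = tens_scale (a * b) x.
Proof.
elim/quotW: x => s; rewrite (tens_scaleE b) !(tens_scaleE _ _).
rewrite /tens_scale_seq -map_comp; congr (\pi_tens _).
by apply: eq_map => p /=; rewrite scalerA.
Qed.
Lemma tens_scale1 : left_id 1 tens_scale.
Proof.
elim/quotW=> s; rewrite (tens_scaleE 1); congr (\pi_tens _).
by rewrite -[RHS]map_id; apply: eq_map => -[u v] /=; rewrite scale1r.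
Qed.
Lemma tens_scaleDr : right_distributive tens_scale +%R.
Proof.
move=> a; elim/quotW=> s; elim/quotW=> t; rewrite -tens_piD (tens_scaleE a (s ++ t)) (tens_scaleE a s).
by rewrite (tens_scaleE a t) /tens_scale_seq map_cat tens_piD.
Qed.
Lemma tens_scaleDl x : {morph tens_scale^~ x : a b / a + b}.
Proof.
elim/quotW: x => s a b; rewrite !(tens_scaleE _ s).
elim: s => [|[u v] s IHs]; first by rewrite -tens_piD.
rewrite -![tens_scale_seq _ (_ :: _)]cat1s !tens_piD IHs addrACA.
congr (_ + _); rewrite -tens_piD /= scalerDl.
by apply/tens_piP; exact: TensDl.
Qed.

Lemma tens_scale0 (x : tens) : tens_scale 0 x = 0.
Proof.
elim/quotW: x => s; rewrite (tens_scaleE 0 s).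
elim: s => [|[u v] s IHs]; first by [].
rewrite -[tens_scale_seq _ (_ :: _)]cat1s tens_piD IHs addr0 /= scale0r.
by apply/tens_piP; exact: Tens0.
Qed.

Definition tens_opp (x : tens) : tens := tens_scale (-1) x.

Lemma tens_addN : left_inverse 0 tens_opp +%R.
Proof.
by move=> x; rewrite -{2}[x]tens_scale1 /tens_opp -tens_scaleDl addNr
                     tens_scale0.
Qed.

HB.instance Definition _ := GRing.Nmodule_isZmodule.Build tens tens_addN.
HB.instance Definition _ := GRing.Zmodule_isLmodule.Build k tens
  tens_scaleA tens_scale1 tens_scaleDr tens_scaleDl.

Definition pure (u : U) (v : V) : tens := \pi_tens [:: (u, v)].

Lemma pureDl u u' v : pure (u + u') v = pure u v + pure u' v.
Proof.
by rewrite /pure -tens_piD; apply/tens_piP; exact: TensDl.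
Qed.
Lemma pureDr u v v' : pure u (v + v') = pure u v + pure u v'.
Proof.
by rewrite /pure -tens_piD; apply/tens_piP; exact: TensDr.
Qed.
Lemma pureZl a u v : pure (a *: u) v = a *: pure u v.
Proof. exact/esym/tens_scaleE. Qed.
Lemma pureZr a u v : pure u (a *: v) = a *: pure u v.
Proof.
by rewrite -pureZl; apply/tens_piP; apply: TensSym; exact: TensZ.
Qed.
Lemma pure0l v : pure 0 v = 0.
Proof. by rewrite -(scale0r 0) pureZl scale0r. Qed.
Lemma pure0r u : pure u 0 = 0.
Proof. by rewrite -(scale0r 0) pureZr scale0r. Qed.

Lemma tens_piE s : \pi_tens s = \sum_(p <- s) pure p.1 p.2.
Proof.
elim: s => [|[u v] s IHs]; first by rewrite big_nil.
by rewrite big_cons -IHs -cat1s tens_piD.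
Qed.

Lemma tens_sumP (x : tens) : exists s, x = \sum_(p <- s) pure p.1 p.2.
Proof. by exists (repr x); rewrite -tens_piE reprK. Qed.

Lemma tens_ind (P : tens -> Prop) :
  P 0 -> (forall x y, P x -> P y -> P (x + y)) -> (forall u v, P (pure u v)) ->
  forall x, P x.
Proof.
move=> P0 PD Pp x; have [s ->] := tens_sumP x.
by elim/big_rec: _ => // p y _ Py; exact: PD.
Qed.

Definition bilin (W : lmodType k) (f : U -> V -> W) : Prop :=
  (forall v, linear (f^~ v)) /\ (forall u, linear (f u)).

(* The linear map induced by f : U -> V -> W; it is meaningful (independent *)
(* of the chosen representative) when f is bilinear, see tliftE.            *)
Definition tlift (W : lmodType k) (f : U -> V -> W) (x : tens) : W :=
  \sum_(p <- repr x) f p.1 p.2.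

Section Lift.
Variables (W : lmodType k) (f : U -> V -> W).
Hypothesis f_bilin : bilin f.

Lemma bilinDl u u' v : f (u + u') v = f u v + f u' v.
Proof. by have := f_bilin.1 v 1 u u'; rewrite !scale1r. Qed.
Lemma bilinDr u v v' : f u (v + v') = f u v + f u v'.
Proof. by have := f_bilin.2 u 1 v v'; rewrite !scale1r. Qed.
Lemma bilin0l v : f 0 v = 0.
Proof. by apply: (addrI (f 0 v)); rewrite -bilinDl !addr0. Qed.
Lemma bilin0r u : f u 0 = 0.
Proof. by apply: (addrI (f u 0)); rewrite -bilinDr !addr0. Qed.
Lemma bilinZl a u v : f (a *: u) v = a *: f u v.
Proof. by have := f_bilin.1 v a u 0; rewrite bilin0l !addr0. Qed.
Lemma bilinZr a u v : f u (a *: v) = a *: f u v.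
Proof. by have := f_bilin.2 u a v 0; rewrite bilin0r !addr0. Qed.

Lemma tens_rel_sum s t : tens_rel s t ->
  \sum_(p <- s) f p.1 p.2 = \sum_(p <- t) f p.1 p.2.
Proof.
elim=> {s t}.
- by [].
- by move=> s t _ ->.
- by move=> s t r _ -> _ ->.
- by move=> s s' t t' _ E1 _ E2; rewrite !big_cat /= E1 E2.
- by move=> s t; rewrite !big_cat /= addrC.
- by move=> u u' v; rewrite !big_cons !big_nil /= bilinDl !addr0.
- by move=> u v v'; rewrite !big_cons !big_nil /= bilinDr !addr0.
- by move=> a u v; rewrite !big_cons !big_nil /= bilinZl bilinZr.
- by move=> v; rewrite !big_cons !big_nil /= bilin0l addr0.
Qed.

Lemma tlift_pi s : tlift f (\pi_tens s) = \sum_(p <- s) f p.1 p.2.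
Proof. by apply: tens_rel_sum; exact: tens_repr. Qed.

Lemma tliftE u v : tlift f (pure u v) = f u v.
Proof. by rewrite tlift_pi big_cons big_nil addr0. Qed.

Lemma tlift_linear : linear (tlift f).
Proof.
move=> a x y; rewrite -[x]reprK -[y]reprK.
rewrite (_ : _ + _ = \pi_tens (tens_scale_seq a (repr x) ++ repr y)); last first.
  by rewrite -tens_addE -tens_scaleE.
rewrite !tlift_pi big_cat /= big_map scaler_sumr; congr (_ + _).
by apply: eq_bigr => p _; rewrite /= bilinZl.
Qed.

Lemma tlift_unique (h : tens -> W) : linear h ->
  (forall u v, h (pure u v) = f u v) -> h =1 tlift f.
Proof.
move=> hl hE x.
have hD y z : h (y + z) = h y + h z by have := hl 1 y z; rewrite !scale1r.
have lD y z : tlift f (y + z) = tlift f y + tlift f z.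
  by have := tlift_linear 1 y z; rewrite !scale1r.
elim/tens_ind: x => [|x y Ex Ey|u v]; last by rewrite hE tliftE.
- by rewrite -(pure0l 0) hE tliftE.
- by rewrite hD lD Ex Ey.
Qed.

End Lift.

End Tensor.

Notation "U ⊗ V" := (tens U V) : type_scope.
Notation "u ⊗t v" := (pure u v) : ring_scope.

Section TensorMaps.
Variable k : fieldType.
Implicit Types U V W X Y : lmodType k.

Lemma tens_eqfun U V W (f g : U ⊗ V -> W) : linear f -> linear g ->
  (forall u v, f (u ⊗t v) = g (u ⊗t v)) -> f =1 g.
Proof.
move=> fl gl fg x.
have b : bilin (fun u v => g (u ⊗t v)).
  split=> [v a u u'|u a v v'].
    by rewrite pureDl pureZl gl.
  by rewrite pureDr pureZr gl.
by rewrite (tlift_unique b fl fg) -(tlift_unique b gl).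
Qed.

Lemma tlift_linear_fun U V W (f g h : U -> V -> W) (a : k) (x : U ⊗ V) :
  (forall u v, h u v = a *: f u v + g u v) ->
  tlift h x = a *: tlift f x + tlift g x.
Proof.
move=> E; rewrite /tlift scaler_sumr -big_split /=.
by apply: eq_bigr => p _; rewrite E.
Qed.

Definition tmap U V X Y (f : U -> X) (g : V -> Y) : U ⊗ V -> X ⊗ Y :=
  tlift (fun u v => f u ⊗t g v).

Lemma tmap_bilin U V X Y (f : U -> X) (g : V -> Y) : linear f -> linear g ->
  bilin (fun u v => f u ⊗t g v).
Proof.
move=> fl gl; split=> [v a u u'|u a v v'].
  by rewrite fl pureDl pureZl.
by rewrite gl pureDr pureZr.
Qed.

Lemma tmapE U V X Y (f : U -> X) (g : V -> Y) : linear f -> linear g ->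
  forall u v, tmap f g (u ⊗t v) = f u ⊗t g v.
Proof. by move=> fl gl u v; rewrite /tmap tliftE//; exact: tmap_bilin. Qed.

Lemma tmap_linear U V X Y (f : U -> X) (g : V -> Y) : linear f -> linear g ->
  linear (tmap f g).
Proof. by move=> fl gl; apply: tlift_linear; exact: tmap_bilin. Qed.

Definition tassoc U V W : (U ⊗ V) ⊗ W -> U ⊗ (V ⊗ W) :=
  tlift (fun x w => tlift (fun u v => u ⊗t (v ⊗t w)) x).

Lemma tassoc_bilin1 U V W (w : W) :
  bilin (fun (u : U) (v : V) => u ⊗t (v ⊗t w)).
Proof.
split=> [v a u u'|u a v v'].
  by rewrite pureDl pureZl.
by rewrite pureDl pureZl pureDr pureZr.
Qed.

Lemma tassoc_bilin U V W : bilin (fun (x : U ⊗ V) (w : W) =>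
  tlift (fun u v => u ⊗t (v ⊗t w)) x).
Proof.
split=> [w|x a w w']; first exact/tlift_linear/tassoc_bilin1.
by apply: tlift_linear_fun => u v; rewrite pureDr pureZr pureDr pureZr.
Qed.

Lemma tassocE U V W (u : U) (v : V) (w : W) :
  tassoc ((u ⊗t v) ⊗t w) = u ⊗t (v ⊗t w).
Proof.
rewrite /tassoc tliftE; last exact: tassoc_bilin.
by rewrite tliftE//; exact: tassoc_bilin1.
Qed.

Lemma tassoc_linear U V W : linear (@tassoc U V W).
Proof. exact/tlift_linear/tassoc_bilin. Qed.

End TensorMaps.

(* The algebra A ⊗ B, with (a ⊗ b)(a' ⊗ b') = aa' ⊗ bb'. *)
Section TensorAlgebra.
Variables (k : fieldType) (A B : algType k).
Implicit Types x y z : A ⊗ B.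

Definition tens_mul x y : A ⊗ B :=
  tlift (fun a b => tlift (fun a' b' => (a * a') ⊗t (b * b')) y) x.
Definition tens_one : A ⊗ B := 1 ⊗t 1.

Lemma tens_mul_bilin1 (a : A) (b : B) :
  bilin (fun a' b' => (a * a') ⊗t (b * b')).
Proof.
split=> [v c u u'|u c v v'].
  by rewrite mulrDr -scalerAr pureDl pureZl.
by rewrite mulrDr -scalerAr pureDr pureZr.
Qed.

Lemma tens_mul_bilin2 y :
  bilin (fun a b => tlift (fun a' b' => (a * a') ⊗t (b * b')) y).
Proof.
split=> [v c u u'|u c v v']; apply: tlift_linear_fun => a' b'.
  by rewrite mulrDl -scalerAl pureDl pureZl.
by rewrite mulrDl -scalerAl pureDr pureZr.
Qed.

Lemma tens_mulE a b a' b' :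
  tens_mul (a ⊗t b) (a' ⊗t b') = (a * a') ⊗t (b * b').
Proof.
rewrite /tens_mul tliftE; last exact: tens_mul_bilin2.
by rewrite tliftE//; exact: tens_mul_bilin1.
Qed.

Lemma tens_mul_bilin : bilin tens_mul.
Proof.
split=> [y|x c y y']; first exact/tlift_linear/tens_mul_bilin2.
apply: tlift_linear_fun => a b.
by rewrite (tlift_linear (tens_mul_bilin1 a b)).
Qed.

Lemma tens_mulDl : left_distributive tens_mul +%R.
Proof. by move=> x y z; rewrite (bilinDl tens_mul_bilin). Qed.
Lemma tens_mulDr : right_distributive tens_mul +%R.
Proof. by move=> x y z; rewrite (bilinDr tens_mul_bilin). Qed.
Lemma tens_mul0l x : tens_mul 0 x = 0.
Proof. exact: (bilin0l tens_mul_bilin). Qed.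
Lemma tens_mul0r x : tens_mul x 0 = 0.
Proof. exact: (bilin0r tens_mul_bilin). Qed.

Lemma tens_mulA : associative tens_mul.
Proof.
move=> x y z; elim/tens_ind: x => [|x x' Ex Ex'|a b].
- by rewrite !tens_mul0l.
- by rewrite !tens_mulDl Ex Ex'.
elim/tens_ind: y => [|y y' Ey Ey'|a' b'].
- by rewrite tens_mul0r !tens_mul0l tens_mul0r.
- by rewrite tens_mulDr !tens_mulDl tens_mulDr Ey Ey'.
elim/tens_ind: z => [|z z' Ez Ez'|a'' b''].
- by rewrite !tens_mul0r.
- by rewrite !tens_mulDr Ez Ez'.
by rewrite !tens_mulE !mulrA.
Qed.
Lemma tens_mul1l : left_id tens_one tens_mul.
Proof.
elim/tens_ind=> [|x y Ex Ey|a b]; rewrite ?tens_mul0r ?tens_mulDr ?Ex ?Ey//.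
by rewrite tens_mulE !mul1r.
Qed.
Lemma tens_mul1r : right_id tens_one tens_mul.
Proof.
elim/tens_ind=> [|x y Ex Ey|a b]; rewrite ?tens_mul0l ?tens_mulDl ?Ex ?Ey//.
by rewrite tens_mulE !mulr1.
Qed.

HB.instance Definition _ := GRing.Zmodule_isPzRing.Build (A ⊗ B)
  tens_mulA tens_mul1l tens_mul1r tens_mulDl tens_mulDr.

End TensorAlgebra.

(* (Δ ⊗ id)Δ = (id ⊗ Δ)Δ up to the associator, ε(h_1)h_2 = h = h_1ε(h_2)    *)
(* and S(h_1)h_2 = ε(h)1 = h_1S(h_2); the antipode need not be bijective.    *)
HB.mixin Record Algebra_isHopf (k : fieldType) H of GRing.Algebra k H := {
  comul : {linear H -> H ⊗ H};
  counit : {lrmorphism H -> k^o};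
  antipode : {linear H -> H};
  comul_monoid_morphism : monoid_morphism comul;
  comulA : forall h : H,
    tassoc (tmap comul idfun (comul h)) = tmap idfun comul (comul h);
  counitl : forall h : H, tlift (fun a b => counit a *: b) (comul h) = h;
  counitr : forall h : H, tlift (fun a b => counit b *: a) (comul h) = h;
  antipodel : forall h : H,
    tlift (fun a b => antipode a * b) (comul h) = (counit h)%:A;
  antipoder : forall h : H,
    tlift (fun a b => a * antipode b) (comul h) = (counit h)%:A
}.

#[short(type="hopfAlgType")]
HB.structure Definition HopfAlgebra (k : fieldType) :=
  {H of GRing.Algebra k H & Algebra_isHopf k H}.

Section FiniteDual.
Variables (k : fieldType) (A : algType k).
Implicit Types (I J : A -> Prop) (u v : A -> k^o).

Definition subspace I : Prop :=
  I 0 /\ forall (a : k) x y, I x -> I y -> I (a *: x + y).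

Definition two_sided_ideal I : Prop :=
  subspace I /\ forall a x, I x -> I (a * x) /\ I (x * a).

(* dim (A / I) < oo: finitely many elements span A modulo I *)
Definition finite_codim I : Prop :=
  exists n (e : 'I_n -> A), forall x,
    exists c : 'I_n -> k, I (x - \sum_i c i *: e i).

Definition in_finite_dual u : Prop :=
  linear u /\
  exists I, [/\ two_sided_ideal I, finite_codim I & forall x, I x -> u x = 0].

Lemma subspaceD I x y : subspace I -> I x -> I y -> I (x + y).
Proof. by move=> -[_ IL] Ix Iy; rewrite -[x]scale1r; exact: IL. Qed.
Lemma subspaceZ I a x : subspace I -> I x -> I (a *: x).
Proof. by move=> -[I0 IL] Ix; rewrite -[_ *: _]addr0; exact: IL. Qed.
Lemma subspaceN I x : subspace I -> I x -> I (- x).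
Proof. by move=> sI Ix; rewrite -scaleN1r; exact: subspaceZ. Qed.
Lemma subspaceB I x y : subspace I -> I x -> I y -> I (x - y).
Proof. by move=> sI Ix Iy; apply: subspaceD => //; exact: subspaceN. Qed.
Lemma subspace_sum I n (x : 'I_n -> A) : subspace I ->
  (forall i, I (x i)) -> I (\sum_i x i).
Proof.
move=> sI Ix; elim/big_rec: _ => [|i y _ Iy]; first exact: sI.1.
exact: subspaceD.
Qed.

(* A basis of a complement of a finite-codimensional subspace, together    *)
(* with the coordinate functionals.                                         *)
Lemma finite_codim_coord I : subspace I -> finite_codim I ->
  exists n (e : 'I_n -> A) (c : 'I_n -> A -> k^o),
    [/\ forall i, linear (c i), forall i x, I x -> c i x = 0
      & forall x, I (x - \sum_i c i x *: e i)].
Proof.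
move=> sI fI.
pose spans n := exists e : 'I_n -> A, forall x,
  exists c : 'I_n -> k, I (x - \sum_i c i *: e i).
have exn : exists n, `[< spans n >].
  by have [n [e eP]] := fI; exists n; apply/asboolP; exists e.
have [n /asboolP [e eP] nmin] := ex_minnP exn.
have indep (c : 'I_n -> k) : I (\sum_i c i *: e i) -> forall i, c i = 0.
  move=> Ic j; apply/eqP/negPn/negP => cj0.
  case: n => [|m] in e eP nmin c Ic j cj0 *; first by case: j cj0.
  suff /asboolP/nmin : spans m by rewrite ltnn.
  exists (e \o lift j) => x; have [d dP] := eP x.
  exists (fun i => d (lift j i) - d j / c j * c (lift j i)).
  have := subspaceD sI dP (subspaceZ (d j / c j) sI Ic).
  congr I; rewrite -addrA; congr (_ + _).
  rewrite (bigD1_ord j)//= [X in _ + _ *: X](bigD1_ord j)//=.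
  rewrite opprD scalerDr scalerA divfK// addrACA addNr add0r.
  rewrite -[LHS]opprK; congr (- _); rewrite opprD opprK scaler_sumr -sumrB.
  by apply: eq_bigr => i _; rewrite scalerBl scalerA.
have [c cP] := choice eP.
have c_uniq x (d : 'I_n -> k) : I (x - \sum_i d i *: e i) -> forall i, c x i = d i.
  move=> dP i; apply/eqP; rewrite -subr_eq0; apply/eqP.
  apply: (indep (fun i => c x i - d i)).
  have := subspaceB sI dP (cP x); congr I.
  rewrite opprB addrC addrA subrK -sumrB.
  by apply: eq_bigr => j _; rewrite scalerBl.
exists n, e, (fun i x => c x i); split=> [i a x y|i x Ix|//].
- apply: (c_uniq _ (fun i => a * c x i + c y i)).
  have := subspaceD sI (subspaceZ a sI (cP x)) (cP y); congr I.
  rewrite scalerBr addrACA -opprD; congr (_ - _).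
  rewrite scaler_sumr -big_split /=; apply: eq_bigr => j _.
  by rewrite scalerDl scalerA.
- by apply: (c_uniq _ (fun=> 0)); rewrite big1 ?subr0// => j _; rewrite scale0r.
Qed.

Lemma finite_codim_ker I u : subspace I -> linear u -> finite_codim I ->
  subspace (fun x => I x /\ u x = 0) /\ finite_codim (fun x => I x /\ u x = 0).
Proof.
move=> sI ul fI; have u0 : u 0 = 0.
  by have := ul (-1) 0 0; rewrite !scaleN1r oppr0 addr0 addNr.
have uZ a x : u (a *: x) = a *: u x by rewrite -[_ *: _]addr0 ul u0 addr0.
have uD x y : u (x + y) = u x + u y by rewrite -[x in LHS]scale1r ul scale1r.
split.
  split=> [|a x y [Ix ux] [Iy uy]]; first by split=> //; exact: sI.1.
  by rewrite ul ux uy scaler0 addr0; split=> //; exact: sI.2.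
have [n [e eP]] := fI.
have [[z [Iz uz]]|nz] := pselect (exists z, I z /\ u z != 0); last first.
  exists n, e => x; have [c cP] := eP x; exists c; split=> //.
  by apply/eqP/negPn/negP => ux; apply: nz; eexists; split; first exact: cP.
exists n.+1, (fun i => oapp e z (unlift ord0 i)) => x; have [c cP] := eP x.
set y := x - _ in cP.
exists (fun i => oapp c (u y / u z) (unlift ord0 i)).
have -> : x - \sum_i oapp c (u y / u z) (unlift ord0 i) *:
   oapp e z (unlift ord0 i) = y + - (u y / u z) *: z.
  rewrite big_ord_recl unlift_none /= opprD addrA addrAC scaleNr.
  congr (_ - _ - _); apply: eq_bigr => i _.
  by rewrite liftK.
split; first by apply: subspaceD => //; exact: subspaceZ.
by rewrite uD uZ /GRing.scale /= mulNr divfK// subrr.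
Qed.

Lemma finite_codimI I J : subspace I -> subspace J ->
  finite_codim I -> finite_codim J -> finite_codim (fun x => I x /\ J x).
Proof.
move=> sI sJ fI /(finite_codim_coord sJ)[m [f [d [dl _ dP]]]].
have /(_ m (leqnn m)) [_ [n [e eP]]] : forall p, (p <= m)%N ->
    subspace (fun x => I x /\ forall i : 'I_m, (i < p)%N -> d i x = 0) /\
    finite_codim (fun x => I x /\ forall i : 'I_m, (i < p)%N -> d i x = 0).
  elim=> [_|p IHp pm].
    have -> : (fun x => I x /\ forall i : 'I_m, (i < 0)%N -> d i x = 0) = I.
      by apply/funext => x; apply/propext; split=> [[]|].
    by [].
  have [s1 f1] := IHp (ltnW pm).
  have := finite_codim_ker s1 (dl (Ordinal pm)) f1.
  suff <- : (fun x => (I x /\ forall i : 'I_m, (i < p)%N -> d i x = 0) /\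
      d (Ordinal pm) x = 0) =
    (fun x => I x /\ forall i : 'I_m, (i < p.+1)%N -> d i x = 0) by [].
  apply/funext => x; apply/propext; split.
    move=> [[Ix dx] dpx]; split=> // i; rewrite ltnS leq_eqVlt => /orP[/eqP ip|].
      by rewrite (_ : i = Ordinal pm)//; exact: val_inj.
    exact: dx.
  move=> [Ix dx]; split; last exact: dx.
  by split=> // i ip; apply: dx; exact: ltnW.
exists n, e => x; have [c [Ix dx]] := eP x; exists c.
move: (x - _) Ix dx => y Iy dy; split=> //; have := dP y.
by rewrite [X in _ - X]big1 ?subr0// => i _; rewrite dy// scale0r.
Qed.

Definition finite_dual_pred : pred (A -> k^o) := fun u => `[< in_finite_dual u >].

Lemma finite_dual_subsemimod : subsemimod_closed finite_dual_pred.
Proof.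
split; first split.
- apply/asboolP; split; first by move=> a x y /=; rewrite scaler0 addr0.
  exists (fun=> True); split=> //.
  by exists 0, (fun=> 0) => x; exists (fun=> 0).
- move=> u v /asboolP[ul [I [[sI iI] fI uI]]] /asboolP[vl [J [[sJ iJ] fJ vJ]]].
  apply/asboolP; split.
    move=> a x y; rewrite -[(u + v) _]/(u _ + v _) ul vl addrACA -scalerDr.
    by [].
  exists (fun x => I x /\ J x); split.
  + split; first split=> [|a x y [Ix Jx] [Iy Jy]].
    * by split; [exact: sI.1|exact: sJ.1].
    * by split; [exact: sI.2|exact: sJ.2].
    * move=> a x [Ix Jx]; have [? ?] := iI a x Ix; have [? ?] := iJ a x Jx.
      by split; split.
  + exact: finite_codimI.
  + by move=> x [Ix Jx]; rewrite -[(u + v) _]/(u _ + v _) uI// vJ// addr0.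
- move=> b u /asboolP[ul [I [iI fI uI]]]; apply/asboolP; split.
    move=> a x y; rewrite -[(b *: u) _]/(b *: u _) ul scalerDr !scalerA mulrC.
    by rewrite -scalerA.
  exists I; split=> // x Ix.
  by rewrite -[(b *: u) _]/(b *: u _) uI// scaler0.
Qed.

HB.instance Definition _ :=
  GRing.isSubmodClosed.Build k (A -> k^o) finite_dual_pred finite_dual_subsemimod.

Record finite_dual := FiniteDual {
  fdual_fun :> A -> k^o;
  fdual_subproof : finite_dual_pred fdual_fun
}.

HB.instance Definition _ := [isSub for fdual_fun].
HB.instance Definition _ := [Choice of finite_dual by <:].
HB.instance Definition _ := [SubChoice_isSubLmodule of finite_dual by <:].

Lemma fdualP (u : finite_dual) : in_finite_dual u.
Proof. exact/asboolP/fdual_subproof. Qed.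
Lemma fdual_linear (u : finite_dual) : linear u.
Proof. exact: (fdualP u).1. Qed.

Definition fdual_of u (pu : in_finite_dual u) : finite_dual :=
  FiniteDual (introT (asboolP _) pu).

Lemma fdual_eqP (u v : finite_dual) : u =1 v -> u = v.
Proof. by move=> uv; apply: val_inj; apply/funext. Qed.

Lemma fdualD (u v : finite_dual) x : (u + v) x = u x + v x.
Proof. by []. Qed.
Lemma fdualZ (a : k) (u : finite_dual) x : (a *: u) x = a * u x.
Proof. by []. Qed.
Lemma fdual0 x : (0 : finite_dual) x = 0.
Proof. by []. Qed.

Notation "A°" := finite_dual.

(* The evaluation (u ⊗ v)(h ⊗ g) = u(h) v(g). *)
Definition dual_eval (t : A° ⊗ A°) (h g : A) : k :=
  tlift (fun u v : A° => (u h * v g : k^o)) t.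

Lemma dual_eval_bilin h g : bilin (fun u v : A° => (u h * v g : k^o)).
Proof.
split=> [v a u u'|u a v v'].
  by rewrite fdualD fdualZ mulrDl -mulrA.
by rewrite fdualD fdualZ mulrDr mulrCA.
Qed.

Lemma dual_evalE (u v : A°) h g : dual_eval (u ⊗t v) h g = u h * v g.
Proof. by rewrite /dual_eval tliftE//; exact: dual_eval_bilin. Qed.

Lemma dual_evalD t t' h g :
  dual_eval (t + t') h g = dual_eval t h g + dual_eval t' h g.
Proof.
have := tlift_linear (dual_eval_bilin h g) 1 t t'.
by rewrite !scale1r.
Qed.

Lemma dual_eval_sum n (u v : 'I_n -> A°) h g :
  dual_eval (\sum_i u i ⊗t v i) h g = \sum_i u i h * v i g.
Proof.
elim/big_rec2: _ => [|i y t _ <-]; last by rewrite dual_evalD dual_evalE.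
have E0 : (0 : A° ⊗ A°) = 0 ⊗t 0 by rewrite pure0l.
by rewrite E0 dual_evalE mul0r.
Qed.

Lemma dual_eval_inj t t' :
  (forall h g, dual_eval t h g = dual_eval t' h g) -> t = t'.
Proof.
move=> E; apply/eqP; rewrite -subr_eq0; apply/eqP.
have {E} : forall h g, dual_eval (t - t') h g = 0.
  move=> h g; apply: (addIr (dual_eval t' h g)).
  by rewrite -dual_evalD subrK E add0r.
move: (t - t') => {t t'} t t0.
pose repn n := exists u v : 'I_n -> A°, t = \sum_i u i ⊗t v i.
have exn : exists n, `[< repn n >].
  have [s ts] := tens_sumP t; exists (size s); apply/asboolP.
  exists (fun i => (tnth (in_tuple s) i).1), (fun i => (tnth (in_tuple s) i).2).
  by rewrite ts big_tnth.
have [n /asboolP[u [v tuv]] nmin] := ex_minnP exn.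
rewrite tuv big1// => j _.
suff -> : u j = 0 by rewrite pure0l.
apply: fdual_eqP => h; rewrite fdual0; apply/eqP/negPn/negP => ujh.
case: n => [|m] in u v tuv nmin j ujh *; first by case: j ujh.
suff /asboolP/nmin : repn m by rewrite ltnn.
have vj : v j = \sum_i (- (u j h)^-1 * u (lift j i) h) *: v (lift j i).
  apply: fdual_eqP => g.
  have := t0 h g; rewrite tuv dual_eval_sum (bigD1_ord j)//= => /eqP.
  rewrite addr_eq0 => /eqP E.
  rewrite -[LHS](mulKf ujh) E.
  rewrite -[RHS]/(fdual_fun (\sum_i _) g).
  have -> : fdual_fun (\sum_i (- (u j h)^-1 * u (lift j i) h) *: v (lift j i)) g
    = \sum_i (- (u j h)^-1 * u (lift j i) h) * v (lift j i) g.
    by elim/big_rec2: _ => // i y w _ <-.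
  rewrite mulrN -mulNr mulr_sumr; apply: eq_bigr => i _.
  by rewrite mulrA.
exists (fun i => u (lift j i) + (- (u j h)^-1 * u (lift j i) h) *: u j).
exists (fun i => v (lift j i)).
rewrite tuv (bigD1_ord j)//= {1}vj.
have -> : u j ⊗t (\sum_i (- (u j h)^-1 * u (lift j i) h) *: v (lift j i)) =
  \sum_i ((- (u j h)^-1 * u (lift j i) h) *: u j) ⊗t v (lift j i).
  elim/big_rec2: _ => [|i y w _ <-]; first by rewrite pure0r.
  by rewrite pureDr pureZr pureZl.
by rewrite -big_split; apply: eq_bigr => i _; rewrite pureDl addrC.
Qed.

Lemma dual_comul_exists (u : A°) :
  exists t : A° ⊗ A°, forall h g, dual_eval t h g = u (h * g).
Proof.
have [ul [I [iI fI uI]]] := fdualP u.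
have [n [e [c [cl cI cP]]]] := finite_codim_coord iI.1 fI.
have cD i : in_finite_dual (c i).
  by split=> //; exists I; split=> //; exact: cI.
have uD i : in_finite_dual (fun h => u (h * e i)).
  split=> [a x y|]; first by rewrite mulrDl -scalerAl ul.
  by exists I; split=> // x Ix; apply: uI; exact: (iI.2 _ _ Ix).2.
exists (\sum_i fdual_of (uD i) ⊗t fdual_of (cD i)) => h g.
rewrite dual_eval_sum /=.
have /uI := (iI.2 h _ (cP g)).1.
have u0 : u 0 = 0 by apply: uI; exact: iI.1.1.
have uDD x y : u (x + y) = u x + u y by rewrite -[x in LHS]scale1r ul scale1r.
have uN x : u (- x) = - u x by rewrite -scaleN1r -[_ *: _]addr0 ul u0 addr0 scaleN1r.
rewrite mulrBr uDD uN => /eqP; rewrite subr_eq0 => /eqP ->.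
rewrite mulr_sumr (big_morph u uDD u0); apply: eq_bigr => i _.
by rewrite -scalerAr -[c i g *: _]addr0 ul u0 addr0 mulrC.
Qed.

(* The comultiplication of A°: the unique element (dual_eval_inj) with     *)
(* Δ(u)(h ⊗ g) = u(hg).                                                    *)
Definition dual_comul (u : A°) : A° ⊗ A° := projT1 (cid (dual_comul_exists u)).

Lemma dual_comulE (u : A°) h g : dual_eval (dual_comul u) h g = u (h * g).
Proof. exact: (projT2 (cid (dual_comul_exists u))). Qed.

End FiniteDual.

Notation "A °" := (finite_dual A) (at level 2, format "A °") : type_scope.

Section Subspaces.
Variables (k : fieldType) (V : lmodType k).

Definition subsp (g : submodClosed V) := {v : V | v \in g}.
HB.instance Definition _ (g : submodClosed V) := SubChoice.on (subsp g).
HB.instance Definition _ (g : submodClosed V) :=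
  [SubChoice_isSubLmodule of subsp g by <:].

Lemma subsp_valP (g : submodClosed V) (a : k) (x y : subsp g) :
  val (a *: x + y) = a *: val x + val y.
Proof. by []. Qed.

Definition finite_dim : Prop :=
  exists n (e : 'I_n -> V), forall v, exists c : 'I_n -> k, v = \sum_i c i *: e i.

End Subspaces.

Section QuantumTangentSpace.
Variables (k : fieldType) (H : hopfAlgType k).

Lemma counit_in_finite_dual : in_finite_dual (counit : H -> k^o).
Proof.
split; first by move=> a x y; rewrite linearP.
exists (fun x => counit x = 0); split=> //.
- split; first split=> [|a x y Ex Ey]; first by rewrite linear0.
    by rewrite linearP /= Ex Ey scaler0 addr0.
  by move=> a x Ex; rewrite !rmorphM /= Ex mulr0 mul0r.
- exists 1, (fun=> 1) => x; exists (fun=> counit x).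
  by rewrite big_ord1 linearB linearZ /= rmorph1 [_ *: 1]mulr1 subrr.
Qed.

Definition dual_one : H° := fdual_of counit_in_finite_dual.

(* The augmentation ideal (H°)^+, the kernel of the counit u |-> u(1). *)
Definition dual_aug (u : H°) : Prop := u 1 = 0.

(* g ⊗ ε + H° ⊗ g, as a subspace of H° ⊗ H° *)
Definition in_tangent_sum (g : submodClosed H°) (t : H° ⊗ H°) : Prop :=
  exists (chi : subsp g) (s : H° ⊗ subsp g),
    t = val chi ⊗t dual_one + tmap idfun val s.

Definition quantum_tangent_space (g : submodClosed H°) : Prop :=
  [/\ forall u, u \in g -> dual_aug u,
      finite_dim (subsp g)
    & forall u, u \in g -> in_tangent_sum g (dual_comul u)].

End QuantumTangentSpace.

Section VectorFieldCalculus.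
Variables (k : fieldType) (A : algType k) (X : lmodType k).

Record is_bimodule (l : A -> X -> X) (r : X -> A -> X) : Prop := IsBimodule {
  lact_bilin : bilin l;
  ract_bilin : bilin r;
  lactM : forall a b x, l (a * b) x = l a (l b x);
  lact1 : forall x, l 1 x = x;
  ractM : forall x a b, r x (a * b) = r (r x a) b;
  ract1 : forall x, r x 1 = x;
  lractA : forall a x b, r (l a x) b = l a (r x b)
}.

(* Bilinearity of L says that each L_x is in End_k(A) and x |-> L_x is linear. *)
Record is_FOVC (l : A -> X -> X) (r : X -> A -> X) (L : X -> A -> A) : Prop :=
  IsFOVC {
    FOVC_bimodule : is_bimodule l r;
    FOVC_bilin : bilin L;
    FOVC_inj : injective L;
    FOVC_lact : forall a x b, L (l a x) b = a * L x b;
    FOVC_leibniz : forall x a b, L x (a * b) = L x a * b + L (r x a) b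
  }.

End VectorFieldCalculus.

Section Covariance.
Variables (k : fieldType) (H : hopfAlgType k).
Implicit Types X Y : lmodType k.

Record is_left_comodule X (rho : X -> H ⊗ X) : Prop := IsLeftComodule {
  lcoact_linear : linear rho;
  lcoactA : forall x, tassoc (tmap comul idfun (rho x)) = tmap idfun rho (rho x);
  lcoact1 : forall x, tlift (fun (h : H) y => counit h *: y) (rho x) = x
}.

(* The H ⊗ H-bimodule structure of H ⊗ X induced by an H-bimodule X:        *)
(* (a ⊗ b)(c ⊗ x) = ac ⊗ bx and (c ⊗ x)(a ⊗ b) = ca ⊗ xb.                   *)
Definition tens_lact X (l : H -> X -> X) (t : H ⊗ H) (z : H ⊗ X) : H ⊗ X :=
  tlift (fun a b => tmap (fun c => a * c) (l b) z) t.
Definition tens_ract X (r : X -> H -> X) (z : H ⊗ X) (t : H ⊗ H) : H ⊗ X :=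
  tlift (fun a b => tmap (fun c => c * a) (r^~ b) z) t.

(* x ⊗ y |-> x_{-1} y_{-1} ⊗ (x_0 ⊗ y_0) *)
Definition diag_coaction X Y (rX : X -> H ⊗ X) (rY : Y -> H ⊗ Y) :
    X ⊗ Y -> H ⊗ (X ⊗ Y) :=
  tlift (fun x y => tlift (fun a x0 => tlift (fun b y0 =>
    (a * b) ⊗t (x0 ⊗t y0)) (rY y)) (rX x)).

Lemma tens_lactE X (l : H -> X -> X) : bilin l ->
  forall a b c x, tens_lact l (a ⊗t b) (c ⊗t x) = (a * c) ⊗t l b x.
Proof.
move=> bl a b c x.
have ml a' : linear (fun c' : H => a' * c').
  by move=> t y z; rewrite mulrDr scalerAr.
have E a' b' := tmapE (ml a') (bl.2 b').
have T a' b' := tmap_linear (ml a') (bl.2 b').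
rewrite /tens_lact tliftE ?E//; split=> [b' t a1 a2|a' t b1 b2];
  move: (c ⊗t x); apply: tens_eqfun => [||c' x'].
- exact: T.
- move=> t' y z; rewrite !T !scalerDr !scalerA addrACA.
  by rewrite mulrC.
- by rewrite !E mulrDl -scalerAl pureDl pureZl.
- exact: T.
- move=> t' y z; rewrite !T !scalerDr !scalerA addrACA.
  by rewrite mulrC.
- by rewrite !E bl.1 pureDr pureZr.
Qed.

Lemma tens_ractE X (r : X -> H -> X) : bilin r ->
  forall c x a b, tens_ract r (c ⊗t x) (a ⊗t b) = (c * a) ⊗t r x b.
Proof.
move=> br c x a b.
have mr a' : linear (fun c' : H => c' * a').
  by move=> t y z; rewrite mulrDl scalerAl.
have E a' b' := tmapE (mr a') (br.1 b').
have T a' b' := tmap_linear (mr a') (br.1 b').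
rewrite /tens_ract tliftE ?E//; split=> [b' t a1 a2|a' t b1 b2];
  move: (c ⊗t x); apply: tens_eqfun => [||c' x'].
- exact: T.
- move=> t' y z; rewrite !T !scalerDr !scalerA addrACA.
  by rewrite mulrC.
- by rewrite !E mulrDr -scalerAr pureDl pureZl.
- exact: T.
- move=> t' y z; rewrite !T !scalerDr !scalerA addrACA.
  by rewrite mulrC.
- by rewrite !E br.2 pureDr pureZr.
Qed.

Lemma diag_bilin1 X Y (a : H) (x : X) :
  bilin (fun (b : H) (y : Y) => (a * b) ⊗t (x ⊗t y)).
Proof.
split=> [y t b b'|b t y y'].
  by rewrite mulrDr -scalerAr pureDl pureZl.
by rewrite pureDr pureZr pureDr pureZr.
Qed.

Lemma diag_bilin2 X Y (z : H ⊗ Y) : bilin (fun (a : H) (x : X) =>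
  tlift (fun b y => (a * b) ⊗t (x ⊗t y)) z).
Proof.
split=> [x t a a'|a t x x']; apply: tlift_linear_fun => b y.
  by rewrite mulrDl -scalerAl pureDl pureZl.
by rewrite pureDl pureZl pureDr pureZr.
Qed.

Lemma diag_coactionE X Y (rX : X -> H ⊗ X) (rY : Y -> H ⊗ Y) :
  linear rX -> linear rY -> forall x y, diag_coaction rX rY (x ⊗t y) =
  tlift (fun a x0 => tlift (fun b y0 => (a * b) ⊗t (x0 ⊗t y0)) (rY y)) (rX x).
Proof.
move=> lX lY x y; rewrite /diag_coaction tliftE//; split=> [y' t z z'|z t y1 y2].
  by rewrite lX (tlift_linear (@diag_bilin2 X Y (rY y'))).
apply: tlift_linear_fun => a x0.
by rewrite lY (tlift_linear (diag_bilin1 Y a x0)).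
Qed.

Definition left_colinear X Y (rX : X -> H ⊗ X) (rY : Y -> H ⊗ Y) (f : X -> Y) :=
  forall x, rY (f x) = tmap idfun f (rX x).

Record is_left_covariant_bimodule X (l : H -> X -> X) (r : X -> H -> X)
    (rho : X -> H ⊗ X) : Prop := IsLeftCovariantBimodule {
  lcov_bimodule : is_bimodule l r;
  lcov_comodule : is_left_comodule rho;
  lcov_compat : forall h x h', rho (r (l h x) h') =
    tens_ract r (tens_lact l (comul h) (rho x)) (comul h')
}.

Record is_left_covariant_FOVC X (l : H -> X -> X) (r : X -> H -> X)
    (L : X -> H -> H) (rho : X -> H ⊗ X) : Prop := IsLeftCovariantFOVC {
  lcov_FOVC : is_FOVC l r L;
  lcov_bimod : is_left_covariant_bimodule l r rho;
  lcov_colinear : left_colinear (diag_coaction rho comul) comul (tlift L)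
}.

End Covariance.

Section InducedCalculus.
Variables (k : fieldType) (H : hopfAlgType k) (g : submodClosed H°).

Definition XH : lmodType k := H ⊗ subsp g.

Definition XH_lact (a : H) : XH -> XH := tmap (fun h => a * h) idfun.

(* L_{h ⊗ χ}(a) = h a_1 χ(a_2) *)
Definition XH_L (x : XH) (a : H) : H :=
  tlift (fun (h : H) (chi : subsp g) =>
    tlift (fun a1 a2 : H => (val chi a2 : k) *: (h * a1)) (comul a)) x.

Lemma XH_L_bilin1 (h : H) (chi : subsp g) :
  bilin (fun a1 a2 : H => (val chi a2 : k) *: (h * a1)).
Proof.
split=> [a2 t a b|a1 t a b].
  by rewrite mulrDr -scalerAr scalerDr !scalerA mulrC.
by rewrite fdual_linear scalerDl scalerA.
Qed.

Lemma XH_L_bilin2 (a : H) : bilin (fun (h : H) (chi : subsp g) =>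
  tlift (fun a1 a2 : H => (val chi a2 : k) *: (h * a1)) (comul a)).
Proof.
split=> [chi t h h'|h t chi chi']; apply: tlift_linear_fun => a1 a2.
  by rewrite mulrDl -scalerAl scalerDr !scalerA mulrC.
by rewrite subsp_valP fdualD fdualZ scalerDl scalerA.
Qed.

Lemma XH_LE (h : H) (chi : subsp g) (a : H) : XH_L (h ⊗t chi) a =
  tlift (fun a1 a2 : H => (val chi a2 : k) *: (h * a1)) (comul a).
Proof. by rewrite /XH_L (tliftE (XH_L_bilin2 a)). Qed.

(* h ⊗ χ |-> h_1 ⊗ (h_2 ⊗ χ) *)
Definition XH_coaction (x : XH) : H ⊗ XH :=
  tlift (fun (h : H) (chi : subsp g) =>
    tlift (fun h1 h2 : H => h1 ⊗t (h2 ⊗t chi : XH)) (comul h)) x.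

Lemma XH_coaction_bilin1 (chi : subsp g) :
  bilin (fun h1 h2 : H => h1 ⊗t (h2 ⊗t chi : XH)).
Proof. exact: tassoc_bilin1. Qed.

Lemma XH_coactionE (h : H) (chi : subsp g) : XH_coaction (h ⊗t chi) =
  tlift (fun h1 h2 : H => h1 ⊗t (h2 ⊗t chi : XH)) (comul h).
Proof.
rewrite /XH_coaction tliftE//; split=> [chi' t a b|a t c c'].
  by rewrite linearP (tlift_linear (XH_coaction_bilin1 chi')).
by apply: tlift_linear_fun => h1 h2; rewrite pureDr pureZr pureDr pureZr.
Qed.

End InducedCalculus.

(* Main.v *)
Require Import Defs.
From HB Require Import structures.
From mathcomp Require Import all_boot all_order all_algebra.
From mathcomp Require Import boolp functions.

Set Implicit Arguments.
Unset Strict Implicit.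
Unset Printing Implicit Defensive.

Import GRing.Theory.
Local Open Scope ring_scope.

(** If L is injective on H ⊗ g, then the Leibniz rule
    L_{X·a}(b) = L_X(ab) - L_X(a) b determines the right action, and everything
    else is a computation with coproducts. If Δ(χ) = χ ⊗ ε + \sum f ⊗ χ', then
    (h ⊗ χ)·a must be \sum h a_1 f(a_2) ⊗ χ', this element does satisfy the
    Leibniz rule [XH_L_ract_of], and the bimodule axioms can be checked after
    applying L [quantum_tangent_FOVC]. Conversely, the counit applied to the
    Leibniz rule gives χ(ab) = χ(a) ε(b) + F_a(b) with F_a in g, which says that
    Δ(χ) - χ ⊗ ε lies in H° ⊗ g [FOVC_quantum_tangent]. Covariance follows from
    the explicit formula of the right action [XH_coaction_compat] and from
    Δ(f ⇀ a) = a_1 ⊗ (f ⇀ a_2), where f ⇀ a = a_1 f(a_2) [XH_L_colinear].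

    The point that needs an idea is injectivity [XH_L_eq0]: if
    \sum h_i a_1 χ_i(a_2) = 0 for all a, then \sum h_i ⊗ χ_i = 0. If the
    antipode S has an inverse, then L_X(a_2) S^-1(a_1) = \sum h_i χ_i(a) and this
    is immediate. For an arbitrary S, put a S(c_1) for a and multiply by c_2 on
    the right: the identity
    Δ(S(c_1)) (c_2 ⊗ 1) = 1 ⊗ S(c) shows that the set P of the b with
    \sum h_i a_1 χ_i(a_2 b) = 0 for all a is stable under left multiplication by
    S(H). As the χ_i are in the finite dual, P has finite codimension. A subspace
    of finite codimension stable under S(H) is a left ideal
    [antipode_stable_left_ideal]: convolution by S on Hom(H, H) is invertible with
    inverse the convolution by the identity, and an invertible operator which
    stabilizes a subspace of finite codimension is also invertible modulo that
    subspace. So P, which contains 1, is H, and taking a = 1 yields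
    \sum h_i χ_i(b) = 0 for all b. *)

(** * Linear and multilinear maps *)

Section LinearMaps.
Variables (k : fieldType) (U V : lmodType k).
Implicit Types (f : U -> V).

Lemma lin_add f : linear f -> {morph f : x y / x + y}.
Proof. by move=> fl x y; have := fl 1 x y; rewrite !scale1r. Qed.

Lemma lin0 f : linear f -> f 0 = 0.
Proof. by move=> fl; apply: (addrI (f 0)); rewrite -lin_add// !addr0. Qed.

Lemma lin_scale f : linear f -> forall a, {morph f : x / a *: x}.
Proof. by move=> fl a x; rewrite -[a *: x]addr0 fl lin0// addr0. Qed.

Lemma lin_opp f : linear f -> {morph f : x / - x}.
Proof. by move=> fl x; rewrite -scaleN1r lin_scale// scaleN1r. Qed.

Lemma lin_sub f : linear f -> {morph f : x y / x - y}.
Proof. by move=> fl x y; rewrite lin_add// lin_opp. Qed.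

Lemma lin_sum f I (r : seq I) (F : I -> U) : linear f ->
  f (\sum_(i <- r) F i) = \sum_(i <- r) f (F i).
Proof. by move=> fl; apply: big_morph; [exact: lin_add|exact: lin0]. Qed.

End LinearMaps.

Section TensorLifts.
Variable k : fieldType.
Implicit Types U V W X : lmodType k.

Lemma lin_comp U V W (g : V -> W) (f : U -> V) :
  linear g -> linear f -> linear (fun x => g (f x)).
Proof. by move=> gl fl a x y; rewrite fl gl. Qed.

Lemma lin_tlift U V W X (f : W -> X) (F : U -> V -> W) x : linear f ->
  f (tlift F x) = tlift (fun u v => f (F u v)) x.
Proof. by move=> fl; rewrite /tlift (lin_sum _ _ fl). Qed.

Lemma eq_tlift U V W (F G : U -> V -> W) x :
  (forall u v, F u v = G u v) -> tlift F x = tlift G x.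
Proof. by move=> FG; apply: eq_bigr => p _; exact: FG. Qed.

Lemma tlift_sum U V W I (r : seq I) (F : I -> U -> V -> W) x :
  tlift (fun u v => \sum_(i <- r) F i u v) x = \sum_(i <- r) tlift (F i) x.
Proof. exact: exchange_big. Qed.

Lemma tlift_exchange U V U' V' W (F : U -> V -> U' -> V' -> W) x y :
  tlift (fun u v => tlift (F u v) y) x =
  tlift (fun u' v' => tlift (fun u v => F u v u' v') x) y.
Proof. exact: exchange_big. Qed.

End TensorLifts.

Definition trilin (k : fieldType) (U V W X : lmodType k)
    (F : U -> V -> W -> X) : Prop :=
  (forall w, bilin (fun u v => F u v w)) /\ (forall u, bilin (F u)).

Section Multilinear.
Variable k : fieldType.
Implicit Types U V W X Y : lmodType k.

Lemma bilin_lin U V W X (F : U -> V -> W) (f : W -> X) :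
  bilin F -> linear f -> bilin (fun u v => f (F u v)).
Proof. by move=> Fb fl; split=> [v a u u'|u a v v']; rewrite ?Fb.1 ?Fb.2 fl. Qed.

Lemma bilin_arg U V X Y W (F : X -> Y -> W) (f : U -> X) (g : V -> Y) :
  bilin F -> linear f -> linear g -> bilin (fun u v => F (f u) (g v)).
Proof.
by move=> Fb fl gl; split=> [v a u u'|u a v v']; rewrite ?fl ?gl ?Fb.1 ?Fb.2.
Qed.

Lemma bilin_pure U V : bilin (@pure k U V).
Proof. by split=> [v a u u'|u a v v']; rewrite ?pureDl ?pureDr ?pureZl ?pureZr. Qed.

Lemma bilin_mul (A : algType k) : bilin (fun a b : A => a * b).
Proof.
by split=> [b a u v|b a u v]; rewrite ?mulrDl ?mulrDr -?scalerAl -?scalerAr.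
Qed.

Lemma lin_id V : linear (fun x : V => x).
Proof. by []. Qed.

Lemma lin_scalel V (c : k) : linear (fun x : V => c *: x).
Proof. by move=> a x y; rewrite scalerDr !scalerA mulrC. Qed.

Lemma lin_scaler V (v : V) : linear (fun c : k^o => (c : k) *: v).
Proof. by move=> a x y; rewrite scalerDl scalerA. Qed.

Lemma lin_mull (A : algType k) (a : A) : linear (fun x : A => a * x).
Proof. exact: (bilin_mul A).2. Qed.

Lemma lin_mulr (A : algType k) (a : A) : linear (fun x : A => x * a).
Proof. exact: (bilin_mul A).1. Qed.

Lemma bilin_scaler U V W (f : V -> k^o) (g : U -> W) : linear f -> linear g ->
  bilin (fun u v => (f v : k) *: g u).
Proof.
move=> fl gl; split=> [v a u u'|u a v v'].
  by rewrite gl scalerDr !scalerA mulrC.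
by rewrite fl scalerDl scalerA.
Qed.

Lemma trilin_l U V W X Y (F : X -> W -> Y) (G : U -> V -> X) :
  bilin F -> bilin G -> trilin (fun u v w => F (G u v) w).
Proof.
move=> Fb Gb; split=> [w|u]; first exact: (bilin_lin Gb (Fb.1 w)).
by split=> [w a v v'|v]; [rewrite Gb.2 Fb.1|exact: Fb.2].
Qed.

Lemma trilin_r U V W X Y (F : U -> X -> Y) (G : V -> W -> X) :
  bilin F -> bilin G -> trilin (fun u v w => F u (G v w)).
Proof.
move=> Fb Gb; split=> [w|u]; last exact: (bilin_lin Gb (Fb.2 u)).
by split=> [v|u a v v']; [exact: Fb.1|rewrite Gb.1 Fb.2].
Qed.

End Multilinear.

(** * Separating elements of a tensor product *)

Section TensorSeparation.
Variables (k : fieldType) (U V : lmodType k).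

(** Induction on the number of terms of x = \sum u_i ⊗ v_i, by a step of
    Gaussian elimination: evaluating at a c with p c u_0 <> 0 yields an element
    w of W that is v_0 plus a combination of the other v_i, so that x - u_0 ⊗ w
    has one term fewer and satisfies the same hypothesis. *)
Lemma tens_sub_of_eval (C : Type) (p : C -> U -> k^o) (W : V -> Prop) :
    (forall c, linear (p c)) -> (forall u, (forall c, p c u = 0) -> u = 0) ->
    W 0 -> (forall a x y, W x -> W y -> W (a *: x + y)) ->
  forall x : U ⊗ V, (forall c, W (tlift (fun u v => (p c u : k) *: v) x)) ->
  exists2 s : seq (U * V), forall q, q \in s -> W q.2
                         & x = \sum_(q <- s) q.1 ⊗t q.2.
Proof.
move=> pl p_sep W0 WL x.
have pb c : bilin (fun u v => (p c u : k) *: v : V).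
  split=> [v a u u'|u a v v']; first by rewrite pl scalerDl scalerA.
  by rewrite scalerDr !scalerA mulrC.
have ex (c : C) (s : seq (U * V)) :
    tlift (fun u v => (p c u : k) *: v) (\sum_(q <- s) q.1 ⊗t q.2) =
    \sum_(q <- s) (p c q.1 : k) *: q.2.
  rewrite (lin_sum _ _ (tlift_linear (pb c))).
  by apply: eq_bigr => q _; rewrite tliftE.
have WZ a y : W y -> W (a *: y) by move=> Wy; rewrite -[_ *: _]addr0; exact: WL.
have [s ->] := tens_sumP x => Ws.
have {x}Ws c : W (\sum_(q <- s) (p c q.1 : k) *: q.2) by rewrite -ex.
move: {2}(size s) (leqnn (size s)) => n; elim: n s Ws => [|n IHn] s Ws.
  by rewrite leqn0 size_eq0 => /eqP ->; exists [::]; rewrite // big_nil.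
case: s Ws => [|[u v] s] Ws /=; first by exists [::].
rewrite ltnS => sn.
have [u0|/existsNP[c /eqP pu]] := pselect (forall c, p c u = 0).
  have [|r rW rE] := IHn s _ sn.
    by move=> c; have := Ws c; rewrite big_cons u0 scale0r add0r.
  by exists r => //; rewrite big_cons rE (p_sep _ u0) pure0l add0r.
pose w := (p c u)^-1 *: \sum_(q <- (u, v) :: s) (p c q.1 : k) *: q.2.
have Ww : W w by apply: WZ; exact: Ws.
pose t := [seq (q.1 - (p c q.1 / p c u) *: u, q.2) | q <- s].
have tE : \sum_(q <- (u, v) :: s) q.1 ⊗t q.2 =
    u ⊗t w + \sum_(q <- t) q.1 ⊗t q.2.
  rewrite /w !big_cons /= scalerDr scalerA mulVf// scale1r pureDr.
  rewrite -addrA; congr (_ + _); rewrite big_map scaler_sumr.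
  have pr y : linear (fun z : V => y ⊗t z : U ⊗ V).
    by move=> a z z'; rewrite pureDr pureZr.
  rewrite (lin_sum _ _ (pr u)) -big_split /=.
  apply: eq_bigr => q _; rewrite scalerA pureZr -pureZl -pureDl.
  by rewrite [_^-1 * _]mulrC addrC subrK.
have tW c' : W (\sum_(q <- t) (p c' q.1 : k) *: q.2).
  have := WL (- (p c' u : k)) _ _ Ww (Ws c'); congr W.
  rewrite -!ex tE (lin_add (tlift_linear (pb c'))).
  by rewrite (tliftE (pb c')) scaleNr addKr.
have [|r rW rE] := IHn t tW; first by rewrite size_map.
exists ((u, w) :: r) => [q|]; first by rewrite inE => /orP[/eqP->|/rW].
by rewrite tE rE big_cons.
Qed.

Lemma tens_eq0_of_eval (C : Type) (p : C -> U -> k^o) :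
    (forall c, linear (p c)) -> (forall u, (forall c, p c u = 0) -> u = 0) ->
  forall x : U ⊗ V, (forall c, tlift (fun u v => (p c u : k) *: v) x = 0) ->
  x = 0.
Proof.
move=> pl p_sep x x0.
have [a y z -> ->|s s0 ->] :=
  @tens_sub_of_eval _ p (fun v => v = 0) pl p_sep erefl _ _ x0.
  by rewrite scaler0 addr0.
by rewrite big_seq big1// => q /s0 ->; rewrite pure0r.
Qed.

End TensorSeparation.

Lemma tens_eq0_of_evalr (k : fieldType) (U V : lmodType k) (C : Type)
    (p : C -> V -> k^o) :
    (forall c, linear (p c)) -> (forall v, (forall c, p c v = 0) -> v = 0) ->
  forall x : U ⊗ V, (forall c, tlift (fun u v => (p c v : k) *: u) x = 0) ->
  x = 0.
Proof.
move=> pl p_sep x x0.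
have sb (X Y : lmodType k) : bilin (fun (u : X) (v : Y) => v ⊗t u).
  by split=> [v a u u'|u a v v']; rewrite ?(pureDl, pureDr) ?(pureZl, pureZr).
have -> : x = tlift (fun v u => u ⊗t v) (tlift (fun u v => v ⊗t u) x).
  elim/tens_ind: x {x0} => [|x y Ex Ey|u v].
  - by rewrite !(lin0 (tlift_linear (sb _ _))).
  - by rewrite !(lin_add (tlift_linear (sb _ _))) -Ex -Ey.
  - by rewrite (tliftE (sb U V)) (tliftE (sb V U)).
rewrite [tlift _ x](_ : _ = 0) ?(lin0 (tlift_linear (sb _ _)))//.
apply: (tens_eq0_of_eval pl p_sep) => c; rewrite -[RHS](x0 c).
have pb : bilin (fun v u => (p c v : k) *: u : U).
  split=> [u a v v'|v a u u']; first by rewrite pl scalerDl scalerA.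
  by rewrite scalerDr !scalerA mulrC.
rewrite (lin_tlift _ _ (tlift_linear pb)).
by apply: eq_tlift => u v; rewrite (tliftE pb).
Qed.

(** * Sweedler calculus *)

Section Sweedler.
Variables (k : fieldType) (H : hopfAlgType k).
Implicit Types (X Y : lmodType k) (h : H).

(** The Sweedler expression F h_1 h_2. *)
Definition sw X h (F : H -> H -> X) : X := tlift F (comul h).

Lemma eq_sw X h (F G : H -> H -> X) :
  (forall a b, F a b = G a b) -> sw h F = sw h G.
Proof. exact: eq_tlift. Qed.

Lemma lin_sw X Y (f : X -> Y) h F : linear f ->
  f (sw h F) = sw h (fun a b => f (F a b)).
Proof. exact: lin_tlift. Qed.

Lemma sw_linear X (F : H -> H -> X) : bilin F -> linear (fun h => sw h F).
Proof.
move=> Fb a x y; rewrite /sw.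
have -> : comul (a *: x + y) = a *: comul x + comul y by rewrite linearP.
exact: tlift_linear.
Qed.

Lemma sw_family X Y (F : X -> H -> H -> Y) h :
  (forall a b, linear (fun x => F x a b)) -> linear (fun x => sw h (F x)).
Proof. by move=> Fl a x y; apply: tlift_linear_fun => u v; rewrite Fl. Qed.

Lemma sw_exchange X (F : H -> H -> H -> H -> X) g h :
  sw h (fun a b => sw g (F a b)) =
  sw g (fun c d => sw h (fun a b => F a b c d)).
Proof. exact: tlift_exchange. Qed.

Lemma sw_comul X h (f : H ⊗ H -> X) : linear f ->
  sw h (fun a b => f (a ⊗t b)) = f (comul h).
Proof.
by move=> fl; rewrite -[in RHS](reprK (comul h)) tens_piE (lin_sum _ _ fl).
Qed.

Lemma sw_mul X g h (F : H -> H -> X) : bilin F ->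
  sw (g * h) F = sw g (fun a b => sw h (fun c d => F (a * c) (b * d))).
Proof.
move=> Fb; rewrite /sw.
have -> : comul (g * h) = comul g * comul h.
  by have [_ ->] := @comul_monoid_morphism k H.
rewrite (lin_tlift _ _ (tlift_linear Fb)); apply: eq_tlift => a b.
rewrite (lin_tlift _ _ (tlift_linear Fb)); apply: eq_tlift => c d.
exact: tliftE.
Qed.

Lemma sw1 X (F : H -> H -> X) : bilin F -> sw 1 F = F 1 1.
Proof.
move=> Fb; rewrite /sw.
have -> : comul (1 : H) = 1 by have [-> _] := @comul_monoid_morphism k H.
exact: tliftE.
Qed.

(** Both sides are the value at Δ²(h) of the linear map on H ⊗ (H ⊗ H) induced
    by F, read off the two sides of the coassociativity axiom. *)
Lemma sw_coassoc X h (F : H -> H -> H -> X) : trilin F ->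
  sw h (fun a b => sw a (fun a1 a2 => F a1 a2 b)) =
  sw h (fun a b => sw b (F a)).
Proof.
move=> [Fl Fr].
pose T := tlift (fun a z => tlift (F a) z).
have Tb : bilin (fun a (z : H ⊗ H) => tlift (F a) z).
  split=> [z c a a'|a]; last exact: tlift_linear.
  by apply: tlift_linear_fun => u v; exact: (Fl v).1.
have Tl : linear T := tlift_linear Tb.
have ER (x : H ⊗ H) :
    T (tmap idfun comul x) = tlift (fun a b => sw b (F a)) x.
  rewrite /tmap (lin_tlift _ _ Tl); apply: eq_bigr => p _.
  by rewrite /T (tliftE Tb).
have EL (x : H ⊗ H) : T (tassoc (tmap comul idfun x)) =
    tlift (fun a b => sw a (fun a1 a2 => F a1 a2 b)) x.
  rewrite /tmap (lin_tlift _ _ (@tassoc_linear _ _ _ _)) (lin_tlift _ _ Tl).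
  apply: eq_bigr => p _.
  rewrite /tassoc (tliftE (@tassoc_bilin _ H H H)) (lin_tlift _ _ Tl).
  by apply: eq_bigr => q _; rewrite /T (tliftE Tb) (tliftE (Fr _)).
by have := congr1 T (comulA h); rewrite ER EL.
Qed.

Lemma sw_counitl X h (f : H -> X) : linear f ->
  sw h (fun a b => (counit a : k) *: f b) = f h.
Proof.
move=> fl; rewrite -[h in RHS]counitl (lin_tlift _ _ fl).
by apply: eq_tlift => a b; rewrite (lin_scale fl).
Qed.

Lemma sw_counitr X h (f : H -> X) : linear f ->
  sw h (fun a b => (counit b : k) *: f a) = f h.
Proof.
move=> fl; rewrite -[h in RHS]counitr (lin_tlift _ _ fl).
by apply: eq_tlift => a b; rewrite (lin_scale fl).
Qed.

Lemma sw_antipodel X h (f : H -> X) : linear f ->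
  sw h (fun a b => f (antipode a * b)) = (counit h : k) *: f 1.
Proof. by move=> fl; rewrite -(lin_scale fl) -antipodel (lin_tlift _ _ fl). Qed.

Lemma sw_antipoder X h (f : H -> X) : linear f ->
  sw h (fun a b => f (a * antipode b)) = (counit h : k) *: f 1.
Proof. by move=> fl; rewrite -(lin_scale fl) -antipoder (lin_tlift _ _ fl). Qed.

End Sweedler.

(** * Subspaces of finite codimension *)

Section FiniteCodimension.
Variables (k : fieldType) (V : lmodType k).
Implicit Types (P : V -> Prop).

Definition spans_mod P n :=
  exists e : 'I_n -> V, forall x, exists c : 'I_n -> k, P (x - \sum_i c i *: e i).

(** A relation with c_j <> 0 would express e_j by the other e_i, giving a
    shorter spanning family. *)
Lemma min_spans_mod_free P n (e : 'I_n -> V) :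
    P 0 -> (forall a x y, P x -> P y -> P (a *: x + y)) ->
    (forall m, spans_mod P m -> (n <= m)%N) ->
    (forall x, exists c : 'I_n -> k, P (x - \sum_i c i *: e i)) ->
  forall c : 'I_n -> k, P (\sum_i c i *: e i) -> forall i, c i = 0.
Proof.
move=> P0 PL nmin eP c Pc j; apply/eqP/negPn/negP => cj0.
case: n => [|m] in e nmin eP c Pc j cj0 *; first by case: j cj0.
suff /nmin : spans_mod P m by rewrite ltnn.
exists (e \o lift j) => x; have [d dP] := eP x.
exists (fun i => d (lift j i) - d j / c j * c (lift j i)).
have := PL (d j / c j) _ _ Pc dP; congr P.
rewrite addrCA; congr (_ + _).
rewrite (bigD1_ord j)//= [X in _ - X](bigD1_ord j)//=.
rewrite scalerDr scalerA divfK// opprD addrACA subrr add0r.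
rewrite scaler_sumr -sumrB -sumrN.
by apply: eq_bigr => i _; rewrite scalerBl scalerA opprB.
Qed.

(** A surjective endomorphism of the finite-dimensional space V / P is
    injective: it maps a shortest spanning family to a spanning family of the
    same length, which is therefore free. *)
Lemma finite_codim_surj_inj P (Phi : V -> V) :
    P 0 -> (forall a x y, P x -> P y -> P (a *: x + y)) ->
    (exists n, spans_mod P n) -> linear Phi ->
    (forall x, P x -> P (Phi x)) -> (forall y, exists x, P (Phi x - y)) ->
  forall x, P (Phi x) -> P x.
Proof.
move=> P0 PL [n0 n0P] Phil PPhi Phi_surj x PPx.
have PB y z : P y -> P z -> P (y - z).
  by move=> Py Pz; rewrite -scaleN1r addrC; exact: PL.
have exn : exists n, `[< spans_mod P n >] by exists n0; apply/asboolP.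
have [n /asboolP[e eP] nmin] := ex_minnP exn.
have Phi_e y (c : 'I_n -> k) :
    Phi (y - \sum_i c i *: e i) = Phi y - \sum_i c i *: Phi (e i).
  rewrite (lin_sub Phil) (lin_sum _ _ Phil); congr (_ - _).
  by apply: eq_bigr => i _; rewrite (lin_scale Phil).
have Phi_eP y : exists c : 'I_n -> k, P (y - \sum_i c i *: Phi (e i)).
  have [z zP] := Phi_surj y; have [c cP] := eP z; exists c.
  by have := PB _ _ (PPhi _ cP) zP; rewrite Phi_e opprB addrC addrA subrK.
have [c cP] := eP x.
have c0 : forall i, c i = 0.
  apply: (min_spans_mod_free P0 PL _ Phi_eP) => [m mP|].
    by apply: nmin; apply/asboolP.
  by have := PB _ _ PPx (PPhi _ cP); rewrite Phi_e subKr.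
by move: cP; rewrite big1 ?subr0// => i _; rewrite c0 scale0r.
Qed.

Lemma finite_codim_kernels (J : eqType) (f : J -> V -> k^o) (r : seq J) :
    (forall j, linear (f j)) ->
  exists n, spans_mod (fun x => forall j, j \in r -> f j x = 0) n.
Proof.
move=> fl; elim: r => [|j0 r [n [e eP]]].
  by exists 0, (fun=> 0) => x; exists (fun=> 0).
have [[z [z0 fz]]|nz] :=
  pselect (exists z, (forall j, j \in r -> f j z = 0) /\ f j0 z != 0); last first.
  exists n, e => x; have [c cP] := eP x; exists c => j.
  rewrite inE => /orP[/eqP ->|]; last exact: cP.
  by apply/eqP/negPn/negP => fx; apply: nz; eexists; split; first exact: cP.
exists n.+1, (fun i => oapp e z (unlift ord0 i)) => x; have [c cP] := eP x.
set y := x - _ in cP.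
exists (fun i => oapp c (f j0 y / f j0 z) (unlift ord0 i)).
have -> : x - \sum_i oapp c (f j0 y / f j0 z) (unlift ord0 i) *:
   oapp e z (unlift ord0 i) = y - (f j0 y / f j0 z) *: z.
  rewrite big_ord_recl unlift_none /= opprD addrA addrAC.
  congr (_ - _ - _); apply: eq_bigr => i _.
  by rewrite liftK.
move=> j; rewrite inE (lin_sub (fl j)) (lin_scale (fl j)).
move=> /orP[/eqP ->|jr]; last by rewrite (cP j jr) (z0 j jr) scaler0 subr0.
by rewrite /GRing.scale /= divfK// subrr.
Qed.

End FiniteCodimension.

(** * Subspaces stable under the antipode *)

Section Endomorphisms.
Variables (k : fieldType) (V : lmodType k).

Definition endo_pred : pred (V -> V) := fun f => `[< linear f >].

Lemma endo_subsemimod : subsemimod_closed endo_pred.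
Proof.
split; first split.
- by apply/asboolP => a x y; rewrite /= scaler0 addr0.
- move=> f f' /asboolP fl /asboolP fl'; apply/asboolP => a x y.
  by rewrite -![(f + f') _]/(f _ + f' _) fl fl' scalerDr addrACA.
- move=> b f /asboolP fl; apply/asboolP => a x y.
  by rewrite -![(b *: f) _]/(b *: f _) fl scalerDr !scalerA mulrC.
Qed.

HB.instance Definition _ :=
  GRing.isSubmodClosed.Build k (V -> V) endo_pred endo_subsemimod.

(** Hom(V, V) has a type of its own, so that finite codimension refers to it and
    not to the space of all functions V -> V. *)
Definition endo : lmodType k :=
  subsp (GRing.SubmodClosed.clone k (V -> V) endo_pred _).

Definition endo_of (f : V -> V) (fl : linear f) : endo :=
  exist _ f (introT (asboolP _) fl).

Lemma endo_linear (f : endo) : linear (val f).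
Proof. exact/asboolP/(valP f). Qed.

Lemma endo_eval_linear x : linear (fun f : endo => val f x).
Proof. by []. Qed.

End Endomorphisms.

Section AntipodeStable.
Variables (k : fieldType) (H : hopfAlgType k).

(** On Hom(H, H), the operator Phi of convolution by the antipode S on the left
    has the right inverse Psi, convolution by the identity. The subspace QP of the maps s with
    a_1 ⊗ s(a_2) in H ⊗ P has finite codimension, because only finitely many
    a_2 occur in Δ(a), and is stable under Phi since P is stable under S(H).
    Being surjective, Phi is injective modulo QP, hence Psi preserves QP. Now
    s = ε(-) p lies in QP, and Psi(s) is x |-> x p, so a_1 ⊗ a_2 p is in H ⊗ P;
    applying ε to the first factor gives a p in P. *)
Lemma antipode_stable_left_ideal (P : H -> Prop) :
    subspace P -> finite_codim P ->
    (forall c x, P x -> P (antipode c * x)) ->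
  forall a x, P x -> P (a * x).
Proof.
move=> sP fP SP a p Pp.
have [n [e [c [cl cP cE]]]] := finite_codim_coord sP fP.
have PE x : (forall i, c i x = 0) -> P x.
  by move=> x0; have := cE x; rewrite big1 ?subr0// => i _; rewrite x0 scale0r.
have mul_lin b : linear (fun x : H => b * x) by exact: lin_mull.
pose conv (f : H -> H) (s : endo H) (x : H) :=
  sw x (fun x1 x2 => f x1 * val s x2).
have conv_bilin (f : H -> H) (s : endo H) : linear f ->
    bilin (fun x1 x2 => f x1 * val s x2).
  by move=> fl; exact: (bilin_arg (bilin_mul H) fl (endo_linear s)).
have conv_lin f (s : endo H) : linear f -> linear (conv f s).
  by move=> fl; apply: sw_linear; exact: conv_bilin.
have Sl : linear (antipode : H -> H) by exact: linearP.
have idl := @lin_id k H.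
pose Phi s := endo_of (conv_lin _ s Sl).
pose Psi s := endo_of (conv_lin _ s idl).
have Phi_lin : linear Phi.
  move=> b s t; apply/val_inj/funext => x.
  rewrite /= -[RHS]/(b *: conv antipode s x + conv antipode t x).
  apply: tlift_linear_fun => x1 x2.
  by rewrite -[val (b *: s + t) x2]/(b *: val s x2 + val t x2) mulrDr scalerAr.
have PhiK s : Phi (Psi s) = s.
  apply/val_inj/funext => x; rewrite /= /conv /=.
  under eq_sw => x1 x2 do rewrite (lin_sw _ _ (mul_lin _)).
  have Ft : trilin (fun x1 x2 x3 : H => antipode x1 * x2 * val s x3).
    have Fb := bilin_arg (bilin_mul H) Sl idl.
    exact: (trilin_l (conv_bilin id s idl) Fb).
  transitivity (sw x (fun x1 x23 => sw x23 (fun x2 x3 =>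
    antipode x1 * x2 * val s x3))).
    by apply: eq_sw => x1 x23; apply: eq_sw => x2 x3; rewrite mulrA.
  rewrite -(sw_coassoc _ Ft).
  under eq_sw => x12 x3
    do rewrite (sw_antipodel _ (lin_mulr (val s x3))) mul1r.
  exact: (sw_counitl _ (endo_linear s)).
(* P is the common kernel of the coordinates c_i, which turns the membership
   of a_1 ⊗ s(a_2) in H ⊗ P into the equations phi i s = 0. *)
pose phi i (s : endo H) : H := sw a (fun a1 a2 => (c i (val s a2) : k) *: a1).
pose QP s := forall i, phi i s = 0.
have c_lin i (s : endo H) : linear (fun x => c i (val s x)) :=
  lin_comp (cl i) (endo_linear s).
have phi_lin i : linear (phi i).
  apply: sw_family => a1 a2 b s t.
  by rewrite -[val _ _]/(b *: val s a2 + val t a2) cl scalerDl scalerA.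
(* phi i (Phi s) is obtained by applying linear maps to the phi j s, because
   c_i (S(a_2) y) depends only on the class of y modulo P. *)
have QP_Phi s : QP s -> QP (Phi s).
  move=> s0 i.
  have cM b (SPb : forall x, P x -> P (b * x)) y :
        c i (b * y) = \sum_j (c j y : k) *: c i (b * e j).
    have := cP i _ (SPb _ (cE y)).
    rewrite mulrBr (lin_sub (cl i)) mulr_sumr (lin_sum _ _ (cl i)).
    move/eqP; rewrite subr_eq0 => /eqP ->; apply: eq_bigr => j _.
    by rewrite -scalerAr (lin_scale (cl i)).
  have E1 : phi i (Phi s) = \sum_j sw a (fun a1 a23 => sw a23 (fun a2 a3 =>
      (c j (val s a3) : k) *: ((c i (antipode a2 * e j) : k) *: a1))).
    rewrite /phi -tlift_sum; apply: eq_sw => a1 a23; rewrite -tlift_sum.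
    rewrite /= /conv (lin_sw _ _ (cl i)).
    rewrite (lin_sw _ _ (lin_scaler a1)); apply: eq_sw => a2 a3.
    rewrite (cM _ (SP a2)) scaler_suml; apply: eq_bigr => j _.
    by rewrite scalerA.
  pose G j d := sw d (fun a1 a2 => (c i (antipode a2 * e j) : k) *: a1).
  have Gb j : bilin (fun a1 a2 : H => (c i (antipode a2 * e j) : k) *: a1).
    apply: (bilin_scaler _ idl).
    exact: (lin_comp (cl i) (lin_comp (lin_mulr (e j)) Sl)).
  rewrite E1 big1// => j _.
  have Ft : trilin (fun a1 a2 a3 : H =>
      (c j (val s a3) : k) *: ((c i (antipode a2 * e j) : k) *: a1)).
    exact: (trilin_l (bilin_scaler (c_lin j s) idl) (Gb j)).
  rewrite -(sw_coassoc _ Ft).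
  have Gl : linear (G j) by apply: sw_linear; exact: Gb.
  transitivity (G j (phi j s)); last by rewrite s0 (lin0 Gl).
  rewrite /phi (lin_sw _ _ Gl); apply: eq_sw => d a3.
  by rewrite -(lin_sw _ _ (lin_scalel _)) (lin_scale Gl).
have QP0 : QP 0 by move=> i; rewrite (lin0 (phi_lin i)).
have QPL b s t : QP s -> QP t -> QP (b *: s + t).
  by move=> s0 t0 i; rewrite (phi_lin i) s0 t0 scaler0 addr0.
have QP_fin : exists m, spans_mod QP m.
  pose r := repr (comul a).
  pose J : finType := ('I_n * 'I_(size r))%type.
  have fl (j : J) : linear (fun s : endo H => c j.1 (val s (nth 0 r j.2).2)).
    exact: (lin_comp (cl j.1) (@endo_eval_linear _ H _)).
  have [m [b bP]] := finite_codim_kernels (enum J) fl.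
  exists m, b => s; have [d dP] := bP s; exists d => i.
  rewrite /phi /sw /tlift (big_nth 0) big_mkord; apply: big1 => l _.
  by rewrite (dP (i, l)) ?scale0r// mem_enum.
have epl : linear (fun x : H => (counit x : k) *: p).
  by move=> b x y; rewrite linearP scalerDl scalerA.
have QP_p : QP (Phi (Psi (endo_of epl))).
  rewrite PhiK => i; apply: big1 => q _ /=.
  by rewrite (lin_scale (cl i)) (cP i p Pp) scaler0 scale0r.
have Phi_surj s : exists t, QP (Phi t - s).
  by exists (Psi s); rewrite PhiK subrr.
have Q := finite_codim_surj_inj QP0 QPL QP_fin Phi_lin QP_Phi Phi_surj QP_p.
apply: PE => i.
have Gb : bilin (fun a1 a2 : H => (c i (a2 * p) : k) *: a1).
  exact: (bilin_scaler (lin_comp (cl i) (lin_mulr p)) idl).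
have El : linear (counit : H -> k^o) by exact: linearP.
have := congr1 counit (Q i); rewrite linear0 => <-.
rewrite /phi (lin_sw _ _ El).
transitivity (sw a (fun a1 a2 => (counit a1 : k) *: c i (a2 * p))).
  by rewrite (sw_counitl _ (lin_comp (cl i) (lin_mulr p))).
apply: eq_sw => a1 a2; rewrite (lin_scale El) [LHS]mulrC.
suff -> : val (Psi (endo_of epl)) a2 = a2 * p by [].
rewrite -(sw_counitr a2 (lin_mulr p)); apply: eq_sw => x1 x2.
by rewrite /= -scalerAr.
Qed.

End AntipodeStable.

(** * Injectivity of the calculus *)

Section AntipodeCoproduct.
Variables (k : fieldType) (H : hopfAlgType k).

Let Sl : linear (antipode : H -> H).
Proof. exact: linearP. Qed.

Lemma lin_comul : linear (comul : H -> H ⊗ H).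
Proof. exact: linearP. Qed.

Lemma comulM (a b : H) : comul (a * b) = comul a * comul b.
Proof. by have [_ ->] := @comul_monoid_morphism k H. Qed.

Lemma comul1 : comul (1 : H) = 1 ⊗t 1.
Proof. by have [-> _] := @comul_monoid_morphism k H. Qed.

Lemma bilin_tens_mul : bilin (fun x y : H ⊗ H => x * y).
Proof. exact: tens_mul_bilin. Qed.

Lemma tens_pureM (a b c d : H) : (a ⊗t b) * (c ⊗t d) = (a * c) ⊗t (b * d).
Proof. exact: tens_mulE. Qed.

(** By coassociativity the left side is c_1 ⊗ c_2 S(c_3). *)
Lemma sw_comul_mulr_antipode (c : H) :
  sw c (fun x y => comul x * (1 ⊗t antipode y)) = c ⊗t 1 :> H ⊗ H.
Proof.
have Fb : bilin (fun x2 y : H => x2 * antipode y).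
  exact: (bilin_arg (bilin_mul H) (@lin_id _ _) Sl).
have Ft : trilin (fun x1 x2 y : H => x1 ⊗t (x2 * antipode y) : H ⊗ H).
  exact: (trilin_r (bilin_pure H H) Fb).
transitivity (sw c (fun x y => sw x (fun x1 x2 =>
  x1 ⊗t (x2 * antipode y) : H ⊗ H))).
  apply: eq_sw => x y; rewrite -(sw_comul x (bilin_tens_mul.1 _)).
  by apply: eq_sw => x1 x2; rewrite tens_pureM mulr1.
rewrite (sw_coassoc _ Ft).
transitivity (sw c (fun x y => (counit y : k) *: (x ⊗t 1 : H ⊗ H))).
  by apply: eq_sw => x y; rewrite (sw_antipoder _ ((bilin_pure H H).2 x)).
exact: (sw_counitr _ ((bilin_pure H H).1 1)).
Qed.

(** Writing y ⊗ 1 = Δ(y_1) (1 ⊗ S(y_2)) makes the product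
    Δ(S(c_1)) Δ(c_2) = Δ(S(c_1) c_2) appear, which collapses to ε. This
    identity removes the first factor of a coproduct by a right multiplication,
    at the price of an antipode in the second factor. *)
Lemma sw_comul_antipode_mull (c : H) :
  sw c (fun x y => comul (antipode x) * (y ⊗t 1)) = 1 ⊗t antipode c :> H ⊗ H.
Proof.
pose B := bilin_tens_mul.
have Sl1 : linear (fun y : H => 1 ⊗t antipode y : H ⊗ H).
  exact: (lin_comp ((bilin_pure H H).2 1) Sl).
have Fb : bilin (fun x y : H => comul x * (1 ⊗t antipode y)).
  exact: (bilin_arg B lin_comul Sl1).
have Ft : trilin (fun x1 x2 y : H =>
    comul (antipode x1) * (comul x2 * (1 ⊗t antipode y))).
  split=> [w|u]; last exact: (bilin_lin Fb (B.2 _)).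
  have Sc := lin_comp lin_comul Sl.
  exact: (bilin_arg B Sc (lin_comp (B.1 _) lin_comul)).
transitivity (sw c (fun x1 z => sw z (fun x2 y =>
    comul (antipode x1) * (comul x2 * (1 ⊗t antipode y))))).
  apply: eq_sw => x1 z.
  by rewrite -(sw_comul_mulr_antipode z) (lin_sw _ _ (B.2 _)).
rewrite -(sw_coassoc _ Ft).
transitivity (sw c (fun x y => (counit x : k) *: (1 ⊗t antipode y : H ⊗ H))).
  apply: eq_sw => z y.
  rewrite -[X in _ = _ *: X]mul1r -[1 in RHS]comul1.
  rewrite -(sw_antipodel z (lin_comp (B.1 (1 ⊗t antipode y)) lin_comul)).
  by apply: eq_sw => x1 x2; rewrite mulrA -comulM.
exact: (sw_counitl _ Sl1).
Qed.

End AntipodeCoproduct.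

Section Injectivity.
Variables (k : fieldType) (H : hopfAlgType k) (g : submodClosed H°).
Implicit Types (X : XH g) (a b : H) (z : H ⊗ H).

Lemma subsp_eval_linear b : linear (fun chi : subsp g => val chi b).
Proof. by move=> c chi chi'; rewrite subsp_valP fdualD fdualZ. Qed.

(** The bilinear expression h u χ(v b) in X = h ⊗ χ and z = u ⊗ v. At z = Δ(a)
    and b = 1 it is L_X(a), and the parameter b lets elements of H act on the
    functionals. *)
Definition XH_eval X z b : H :=
  tlift (fun (h : H) (chi : subsp g) =>
    tlift (fun u v : H => (val chi (v * b) : k) *: (h * u)) z) X.

Lemma XH_eval_bilin1 (h : H) (chi : subsp g) b :
  bilin (fun u v : H => (val chi (v * b) : k) *: (h * u)).
Proof.
apply: bilin_scaler; last exact: lin_mull.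
exact: (lin_comp (@fdual_linear _ _ (val chi)) (lin_mulr b)).
Qed.

Lemma XH_eval_linear X b : linear (fun z => XH_eval X z b).
Proof.
move=> c z z'; apply: tlift_linear_fun => h chi.
exact: (tlift_linear (XH_eval_bilin1 h chi b)).
Qed.

Lemma XH_eval_linearr X z : linear (XH_eval X z).
Proof.
move=> c b b'; apply: tlift_linear_fun => h chi; apply: tlift_linear_fun => u v.
by rewrite mulrDr -scalerAr fdual_linear scalerDl scalerA.
Qed.

Lemma XH_evalE X a : XH_eval X (comul a) 1 = XH_L X a.
Proof. by apply: eq_tlift => h chi; apply: eq_tlift => u v; rewrite mulr1. Qed.

Lemma XH_eval_pure X u v b : XH_eval X (u ⊗t v) b =
  tlift (fun (h : H) (chi : subsp g) => (val chi (v * b) : k) *: (h * u)) X.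
Proof. by apply: eq_tlift => h chi; rewrite (tliftE (XH_eval_bilin1 h chi b)). Qed.

Lemma XH_eval_mulr X z c b : XH_eval X z (c * b) = XH_eval X (z * (1 ⊗t c)) b.
Proof.
have B := bilin_tens_mul H.
move: z; apply: tens_eqfun; first exact: XH_eval_linear.
  exact: (lin_comp (XH_eval_linear X b) (B.1 _)).
by move=> u v; rewrite tens_pureM !XH_eval_pure mulr1 mulrA.
Qed.

Lemma XH_eval_mull X z c b : XH_eval X (z * (c ⊗t 1)) b = XH_eval X z b * c.
Proof.
have B := bilin_tens_mul H.
move: z; apply: tens_eqfun; first exact: (lin_comp (XH_eval_linear X b) (B.1 _)).
  exact: (lin_comp (lin_mulr c) (XH_eval_linear X b)).
move=> u v; rewrite tens_pureM !XH_eval_pure mulr1 (lin_tlift _ _ (lin_mulr c)).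
by apply: eq_tlift => h chi; rewrite -scalerAl mulrA.
Qed.

Lemma fdual_common_ideal (r : seq (H * subsp g)) : exists I : H -> Prop,
  [/\ two_sided_ideal I, finite_codim I
    & forall q, q \in r -> forall x, I x -> val q.2 x = 0].
Proof.
elim: r => [|q r [J [[sJ iJ] fJ JP]]].
  exists (fun=> True); split=> //.
  by exists 0, (fun=> 0) => x; exists (fun=> 0).
have [_ [I [[sI iI] fI uI]]] := fdualP (val q.2).
exists (fun x => I x /\ J x); split.
- split; first split=> [|a x y [Ix Jx] [Iy Jy]].
  + by split; [exact: sI.1|exact: sJ.1].
  + by split; [exact: sI.2|exact: sJ.2].
  + move=> a x [Ix Jx]; have [? ?] := iI a x Ix; have [? ?] := iJ a x Jx.
    by split; split.
- exact: finite_codimI.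
- move=> q'; rewrite inE => /orP[/eqP->|q'r] x [Ix Jx]; first exact: uI.
  exact: JP q'r x Jx.
Qed.

(** For X = \sum h_i ⊗ χ_i, the set P of the b with
    \sum h_i a_1 χ_i(a_2 b) = 0 for all a contains 1, has finite codimension
    because the χ_i vanish on a common ideal of finite codimension, and is stable
    under S(H) by [sw_comul_antipode_mull]. By [antipode_stable_left_ideal] it is
    a left ideal, hence all of H. Then a = 1 gives \sum h_i χ_i(b) = 0 for all b,
    and the evaluations at b separate the elements of g. *)
Lemma XH_L_eq0 X : (forall a, XH_L X a = 0) -> X = 0.
Proof.
move=> X0; pose P b := forall a, XH_eval X (comul a) b = 0.
have sP : subspace P.
  split=> [a|c b b' Pb Pb' a]; first exact: (lin0 (XH_eval_linearr X _)).
  by rewrite XH_eval_linearr Pb Pb' scaler0 addr0.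
have [I [[sI iI] [n [e eP]] IP]] := fdual_common_ideal (repr X).
have fP : finite_codim P.
  exists n, e => x; have [c cP] := eP x; exists c => a.
  apply: big1_seq => q /andP[_ qr]; apply: big1 => p _.
  by rewrite (IP q qr) ?scale0r//; exact: (iI _ _ cP).1.
have SP c b : P b -> P (antipode c * b).
  move=> Pb a; rewrite XH_eval_mulr -sw_comul_antipode_mull.
  rewrite (lin_sw _ _ ((bilin_tens_mul H).2 _)).
  rewrite (lin_sw _ _ (XH_eval_linear X b)).
  apply: big1 => q _.
  by rewrite mulrA -comulM XH_eval_mull Pb mul0r.
have P1 : P 1 by move=> a; rewrite XH_evalE.
apply: (@tens_eq0_of_evalr _ _ _ H (fun b (chi : subsp g) => val chi b)).
- exact: subsp_eval_linear.
- by move=> chi chi0; apply: val_inj; apply: fdual_eqP => b; rewrite chi0.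
move=> b; have := antipode_stable_left_ideal sP fP SP b P1 1.
rewrite mulr1 comul1 XH_eval_pure => <-; apply: eq_tlift => h chi.
by rewrite mulr1 mul1r.
Qed.

End Injectivity.

(** * The right action on a quantum tangent space *)

Section RightAction.
Variables (k : fieldType) (H : hopfAlgType k) (g : submodClosed H°).
Implicit Types (X Y : XH g) (a b : H) (chi : subsp g).

Lemma XH_L_bilin : bilin (@XH_L k H g).
Proof.
split=> [a|X]; first exact: (tlift_linear (XH_L_bilin2 g a)).
move=> c a b; apply: tlift_linear_fun => h chi.
by rewrite linearP (tlift_linear (XH_L_bilin1 h chi)).
Qed.

Lemma XH_L_inj : injective (@XH_L k H g).
Proof.
move=> X Y XY; apply/eqP; rewrite -subr_eq0; apply/eqP.
by apply: XH_L_eq0 => a; rewrite (lin_sub (XH_L_bilin.1 a)) XY subrr.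
Qed.

Lemma XH_lact_pure c (h : H) chi : XH_lact c (h ⊗t chi) = (c * h) ⊗t chi.
Proof. by rewrite /XH_lact tmapE//; exact: lin_mull. Qed.

Lemma XH_lact_bilin : bilin (@XH_lact k H g).
Proof.
split=> [X|c]; last by apply: tmap_linear => //; exact: lin_mull.
move=> c a b; apply: tlift_linear_fun => h chi.
by rewrite mulrDl -scalerAl pureDl pureZl.
Qed.

(** The left action f ⇀ a = a_1 f(a_2) of functionals. *)
Definition hit (f : H -> k^o) a : H := sw a (fun a1 a2 => (f a2 : k) *: a1).

Lemma hit_bilin (f : H -> k^o) : linear f ->
  bilin (fun a1 a2 : H => (f a2 : k) *: a1).
Proof. by move=> fl; exact: (bilin_scaler fl (@lin_id _ H)). Qed.

Lemma XH_L_pure (h : H) chi a : XH_L (h ⊗t chi) a = h * hit (val chi) a.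
Proof.
rewrite XH_LE /hit (lin_sw _ _ (lin_mull h)).
by apply: eq_sw => a1 a2; rewrite scalerAr.
Qed.

(** The equation Δ(χ) = χ ⊗ ε + s, evaluated at a ⊗ b. *)
Definition tangent_rep chi (s : H° ⊗ subsp g) : Prop := forall a b,
  val chi (a * b) = (val chi a : k) * counit b +
    tlift (fun (f : H°) (chi' : subsp g) => (f a * val chi' b : k^o)) s.

(** The value that the Leibniz rule forces on (h ⊗ χ)·a when
    Δ(χ) = χ ⊗ ε + s with s = \sum f ⊗ χ': it is \sum h a_1 f(a_2) ⊗ χ'. *)
Definition ract_of (s : H° ⊗ subsp g) (h a : H) : XH g :=
  tlift (fun (f : H°) (chi' : subsp g) => (h * hit f a) ⊗t chi') s.

Lemma XH_L_ract_of chi s (h : H) a b : tangent_rep chi s ->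
  XH_L (ract_of s h a) b = XH_L (h ⊗t chi) (a * b) - XH_L (h ⊗t chi) a * b.
Proof.
move=> chis; rewrite (lin_tlift _ _ (XH_L_bilin.1 b)).
rewrite !XH_L_pure -mulrA -mulrBr.
transitivity (h * tlift (fun (f : H°) chi' => hit f a * hit (val chi') b) s).
  rewrite (lin_tlift _ _ (lin_mull h)); apply: eq_tlift => f chi'.
  by rewrite XH_L_pure mulrA.
congr (_ * _); apply/esym/eqP; rewrite subr_eq; apply/eqP.
rewrite {1}/hit (sw_mul _ _ (hit_bilin (@fdual_linear _ _ (val chi)))).
transitivity (sw a (fun a1 a2 => sw b (fun b1 b2 =>
  (tlift (fun (f : H°) (chi' : subsp g) => (f a2 * val chi' b2 : k^o)) s : k)
    *: (a1 * b1))) +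
  sw a (fun a1 a2 => sw b (fun b1 b2 =>
    ((val chi a2 : k) * counit b2) *: (a1 * b1)))).
  rewrite /sw /tlift -big_split; apply: eq_bigr => p _.
  rewrite -big_split; apply: eq_bigr => q _ /=.
  by rewrite chis scalerDl addrC.
congr (_ + _); last first.
  rewrite (lin_sw _ _ (lin_mulr b)); apply: eq_sw => a1 a2.
  rewrite -scalerAl -(sw_counitr b (lin_mull a1)) (lin_sw _ _ (lin_scalel _)).
  by apply: eq_sw => b1 b2; rewrite scalerA.
transitivity (sw a (fun a1 a2 => sw b (fun b1 b2 =>
  tlift (fun (f : H°) (chi' : subsp g) =>
    (f a2 * val chi' b2 : k) *: (a1 * b1)) s))).
  apply: eq_sw => a1 a2; apply: eq_sw => b1 b2.
  by rewrite (lin_tlift _ _ (lin_scaler _)).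
transitivity (tlift (fun (f : H°) (chi' : subsp g) => sw a (fun a1 a2 =>
  sw b (fun b1 b2 => (f a2 * val chi' b2 : k) *: (a1 * b1)))) s).
  rewrite [RHS]tlift_exchange; apply: eq_sw => a1 a2.
  by rewrite [RHS]tlift_exchange.
apply: eq_tlift => f chi'; rewrite (lin_sw _ _ (lin_mulr _)).
apply: eq_sw => a1 a2; rewrite (lin_sw _ _ (lin_mull _)).
by apply: eq_sw => b1 b2; rewrite -scalerAl -scalerAr scalerA.
Qed.

(** The component of Δ(χ) along ε is χ itself: evaluate at a ⊗ 1, where the
    elements of g vanish. *)
Lemma quantum_tangent_rep : quantum_tangent_space g ->
  forall chi, exists s, tangent_rep chi s.
Proof.
move=> [g_aug _ gD] chi; have [chi' [s sE]] := gD _ (valP chi); exists s.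
have dE a b : val chi (a * b) = (val chi' a : k) * counit b +
    tlift (fun (f : H°) (chi' : subsp g) => (f a * val chi' b : k^o)) s.
  rewrite -dual_comulE sE dual_evalD dual_evalE; congr (_ + _).
  rewrite /dual_eval /tmap (lin_tlift _ _ (tlift_linear (dual_eval_bilin a b))).
  by apply: eq_tlift => f psi; rewrite (tliftE (dual_eval_bilin a b)).
suff chiE a : val chi a = val chi' a by move=> a b; rewrite dE chiE.
have := dE a 1; rewrite mulr1 => ->; rewrite rmorph1 mulr1 [X in _ + X]big1 ?addr0//.
by move=> q _; rewrite (g_aug _ (valP q.2)) mulr0.
Qed.

Lemma FOVC_ract_pure (r : XH g -> H -> XH g) chi s (h : H) a :
  is_FOVC (@XH_lact k H g) r (@XH_L k H g) -> tangent_rep chi s ->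
  r (h ⊗t chi) a = ract_of s h a.
Proof.
move=> [_ _ _ _ Lr] chis; apply: XH_L_inj; apply/funext => b.
by rewrite (XH_L_ract_of _ _ _ chis) Lr addrC addKr.
Qed.

(** The element X·a is the one whose operator is b |-> L_X(ab) - L_X(a) b. Such
    an element exists by [XH_L_ract_of], and since L is injective every axiom of a
    right action can be checked on operators. *)
Lemma quantum_tangent_FOVC : quantum_tangent_space g ->
  exists r, is_FOVC (@XH_lact k H g) r (@XH_L k H g).
Proof.
move=> gq; have L := XH_L_bilin.
have rex X a : exists Y, forall b, XH_L Y b = XH_L X (a * b) - XH_L X a * b.
  elim/tens_ind: X => [|X X' [Y YE] [Y' YE']|h chi].
  - by exists 0 => b; rewrite !(bilin0l L) mul0r subr0.
  - exists (Y + Y') => b; rewrite !(bilinDl L) YE YE'.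
    by rewrite mulrDl opprD addrACA.
  - have [s chis] := quantum_tangent_rep gq chi.
    by exists (ract_of s h a) => b; exact: XH_L_ract_of.
pose r X a := projT1 (cid (rex X a)).
have rE X a b : XH_L (r X a) b = XH_L X (a * b) - XH_L X a * b.
  exact: (projT2 (cid (rex X a))).
have Leq X Y : (forall b, XH_L X b = XH_L Y b) -> X = Y.
  by move=> XY; apply: XH_L_inj; apply/funext.
have lL c X b : XH_L (XH_lact c X) b = c * XH_L X b.
  elim/tens_ind: X => [|X X' EX EX'|h chi].
  - by rewrite (bilin0r XH_lact_bilin) !(bilin0l L) mulr0.
  - by rewrite (bilinDr XH_lact_bilin) !(bilinDl L) EX EX' mulrDr.
  - by rewrite XH_lact_pure !XH_L_pure mulrA.
have LDl c X Y b : XH_L (c *: X + Y) b = c *: XH_L X b + XH_L Y b.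
  exact: L.1.
have LDr c X a b : XH_L X (c *: a + b) = c *: XH_L X a + XH_L X b.
  exact: L.2.
exists r; split; [split| | | |] => //.
- exact: XH_lact_bilin.
- split=> [a c X Y|X c a b]; apply: Leq => d; rewrite LDl !rE.
    by rewrite !LDl mulrDl -scalerAl opprD addrACA -scalerBr.
  by rewrite mulrDl -scalerAl !LDr mulrDl -scalerAl opprD addrACA -scalerBr.
- by move=> a b X; apply: Leq => c; rewrite !lL mulrA.
- by move=> X; apply: Leq => c; rewrite lL mul1r.
- move=> X a b; apply: Leq => c; rewrite !rE !mulrA mulrBl.
  by rewrite opprB addrA subrK.
- move=> X; apply: Leq => c; rewrite rE mul1r.
  (* unitality of the action is the vanishing of the elements of g at 1 *)
  have -> : XH_L X 1 = 0.
    elim/tens_ind: X => [|X X' EX EX'|h chi].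
    + by rewrite (bilin0l L).
    + by rewrite (bilinDl L) EX EX' addr0.
    + rewrite XH_L_pure /hit (sw1 (hit_bilin (@fdual_linear _ _ _))).
      by have [g_aug _ _] := gq; rewrite g_aug ?(valP chi)// scale0r mulr0.
  by rewrite mul0r subr0.
- by move=> a X b; apply: Leq => c; rewrite rE !lL rE mulrBr mulrA.
- exact: XH_L_inj.
- by move=> X a b; rewrite rE addrC subrK.
Qed.

End RightAction.

(** * The tangent space of a calculus *)

Section TangentOfCalculus.
Variables (k : fieldType) (H : hopfAlgType k) (g : submodClosed H°).

Lemma counit_hit (f : H -> k^o) a : linear f -> counit (hit f a) = f a.
Proof.
move=> fl; have El : linear (counit : H -> k^o) by exact: linearP.
rewrite /hit (lin_sw _ _ El) -[RHS](sw_counitl a fl); apply: eq_sw => a1 a2.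
by rewrite (lin_scale El) [LHS]mulrC.
Qed.

(** The map ε ⊗ id : H ⊗ g -> g, which reads the functional ε ∘ L_Y off Y by
    [counit_XH_L]. *)
Definition counit_coef (Y : XH g) : subsp g :=
  tlift (fun (h : H) (chi : subsp g) => (counit h : k) *: chi) Y.

Lemma counit_coef_bilin :
  bilin (fun (h : H) (chi : subsp g) => (counit h : k) *: chi).
Proof.
split=> [chi c h h'|h c chi chi'].
  by rewrite linearP scalerDl scalerA.
by rewrite scalerDr !scalerA mulrC.
Qed.

Lemma counit_XH_L (Y : XH g) (b : H) :
  counit (XH_L Y b) = val (counit_coef Y) b :> k.
Proof.
have El : linear (counit : H -> k^o) by exact: linearP.
move: Y; apply: (@tens_eqfun _ _ _ k^o) => [||h chi].
- exact: (lin_comp El ((XH_L_bilin g).1 b)).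
- exact: (lin_comp (subsp_eval_linear b) (tlift_linear counit_coef_bilin)).
rewrite XH_L_pure /counit_coef (tliftE counit_coef_bilin).
rewrite (lin_scale (subsp_eval_linear b)).
rewrite -(counit_hit b (@fdual_linear _ _ (val chi))).
exact: rmorphM.
Qed.

(** Applying ε to the Leibniz rule of χ gives χ(ab) = χ(a) ε(b) + F_a(b), where
    F_a = (ε ⊗ id)((1 ⊗ χ)·a) lies in g. So the left evaluations at a of
    t = Δ(χ) - χ ⊗ ε all lie in g, which by [tens_sub_of_eval] places t in
    H° ⊗ g. *)
Lemma FOVC_quantum_tangent (r : XH g -> H -> XH g) :
    (forall u, u \in g -> dual_aug u) -> finite_dim (subsp g) ->
    is_FOVC (@XH_lact k H g) r (@XH_L k H g) -> quantum_tangent_space g.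
Proof.
move=> g_aug g_fin [_ _ _ _ Lr]; split=> // u ug.
pose chi : subsp g := Sub u ug.
pose F a := counit_coef (r (1 ⊗t chi) a).
have chiE : counit_coef (1 ⊗t chi) = chi.
  by rewrite /counit_coef (tliftE counit_coef_bilin) rmorph1 scale1r.
have uM a b : u (a * b) = (u a : k) * counit b + val (F a) b.
  rewrite /F -counit_XH_L -[u]/(val chi) -{1 2}chiE -!counit_XH_L Lr.
  by rewrite rmorphD rmorphM.
pose t := dual_comul u - u ⊗t dual_one H.
pose p (a : H) (v : H°) : k^o := v a.
have pl a : linear (p a) by move=> c v w; rewrite /p fdualD fdualZ.
have p_sep v : (forall a, p a v = 0) -> v = 0.
  by move=> v0; apply: fdual_eqP => a; rewrite fdual0; exact: v0.
have tg a : tlift (fun v w : H° => (p a v : k) *: w) t \in g.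
  suff -> : tlift (fun v w : H° => (p a v : k) *: w) t = val (F a).
    exact: valP.
  apply: fdual_eqP => b; rewrite -[LHS]/(p b _) (lin_tlift _ _ (pl b)).
  rewrite -[LHS]/(dual_eval t a b).
  have dl : linear (fun z : H° ⊗ H° => dual_eval z a b : k^o).
    exact: (tlift_linear (dual_eval_bilin a b)).
  rewrite (lin_sub dl) /= dual_comulE dual_evalE uM addrC.
  by rewrite addKr.
have gL (c : k) (x y : H°) : x \in g -> y \in g -> c *: x + y \in g.
  by move=> xg yg; rewrite rpredD// rpredZ.
have [s sg tE] := @tens_sub_of_eval _ _ _ _ p (fun v => v \in g) pl p_sep
  (rpred0 g) gL t tg.
have Tl : linear (tmap (idfun : H° -> H°) (val : subsp g -> H°)).
  by apply: tmap_linear.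
have [s' s'E] : exists s' : H° ⊗ subsp g, tmap idfun val s' = t.
  rewrite tE; elim: s sg {tE} => [|q s IHs] sg.
    by exists 0; rewrite big_nil (lin0 Tl).
  have [|s' s'E] := IHs; first by move=> q' q's; apply: sg; rewrite inE q's orbT.
  have qg : q.2 \in g by apply: sg; rewrite mem_head.
  exists (q.1 ⊗t (Sub q.2 qg) + s').
  by rewrite (lin_add Tl) s'E big_cons tmapE.
by exists chi, s'; rewrite s'E /t addrC subrK.
Qed.

End TangentOfCalculus.

(** * Left covariance *)

Section CovarianceOfCalculus.
Variables (k : fieldType) (H : hopfAlgType k) (g : submodClosed H°).
Implicit Types (X : XH g) (a b h : H) (chi : subsp g).

(** Δ(f ⇀ a) = a_1 ⊗ (f ⇀ a_2), by coassociativity. *)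
Lemma sw_hit (f : H -> k^o) a (V : lmodType k) (G : H -> H -> V) :
  linear f -> bilin G ->
  sw (hit f a) G = sw a (fun a1 a2 => G a1 (hit f a2)).
Proof.
move=> fl Gb; rewrite {1}/hit (lin_sw _ _ (sw_linear Gb)).
have Ft : trilin (fun a1 a2 a3 : H => (f a3 : k) *: G a1 a2).
  exact: (trilin_l (bilin_scaler fl (@lin_id k V)) Gb).
transitivity (sw a (fun a1 a2 => sw a1 (fun x y => (f a2 : k) *: G x y))).
  apply: eq_sw => a1 a2; rewrite (lin_scale (sw_linear Gb)).
  by rewrite (lin_sw _ _ (lin_scalel _)).
rewrite (sw_coassoc _ Ft); apply: eq_sw => a1 a2.
rewrite /hit (lin_sw _ _ (Gb.2 a1)); apply: eq_sw => x y.
by rewrite (lin_scale (Gb.2 a1)).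
Qed.

Lemma XH_coaction_linear : linear (@XH_coaction k H g).
Proof.
apply: tlift_linear; split=> [chi c a b|a c chi chi'].
  exact: (sw_linear (@XH_coaction_bilin1 k H g chi)).
by apply: tlift_linear_fun => h1 h2; rewrite pureDr pureZr pureDr pureZr.
Qed.

Lemma XH_coaction_pure h chi :
  XH_coaction (h ⊗t chi) = sw h (fun h1 h2 => h1 ⊗t (h2 ⊗t chi : XH g)).
Proof. exact: XH_coactionE. Qed.

Lemma XH_coaction_comodule : is_left_comodule (@XH_coaction k H g).
Proof.
have rl := XH_coaction_linear.
have cl := @lin_comul k H.
have il (V : lmodType k) : linear (idfun : V -> V) := @lin_id k V.
split=> //.
- have T1 :=
    lin_comp (@tassoc_linear _ H H (XH g)) (tmap_linear cl (@il (XH g))).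
  have T2 := tmap_linear (@il H) rl.
  apply: tens_eqfun => [||h chi].
  + exact: (lin_comp T1 rl).
  + exact: (lin_comp T2 rl).
  rewrite XH_coaction_pure (lin_sw _ _ T1) (lin_sw _ _ T2).
  have Ft : trilin (fun x y z : H => x ⊗t (y ⊗t (z ⊗t chi : XH g))).
    apply: (trilin_r (bilin_pure _ _)).
    exact: (bilin_arg (bilin_pure _ _) (@lin_id k H) ((bilin_pure H _).1 chi)).
  transitivity (sw h (fun a b => sw a (fun x y =>
      x ⊗t (y ⊗t (b ⊗t chi : XH g))))).
    apply: eq_sw => a b; rewrite (tmapE cl (@il _)).
    rewrite -(sw_comul a
      (lin_comp (@tassoc_linear _ H H _) ((bilin_pure _ _).1 _))).
    by apply: eq_sw => x y; rewrite tassocE.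
  rewrite (sw_coassoc _ Ft); apply: eq_sw => a b.
  rewrite (tmapE (@il _) rl) XH_coaction_pure.
  by rewrite (lin_sw _ _ ((bilin_pure _ _).2 _)).
- have Cb : bilin (fun (h : H) (Y : XH g) => (counit h : k) *: Y).
    split=> [Y c a b|a c Y Y']; first by rewrite linearP scalerDl scalerA.
    by rewrite scalerDr !scalerA mulrC.
  have Cl := tlift_linear Cb.
  apply: tens_eqfun; [exact: (lin_comp Cl rl)|by []|move=> h chi].
  rewrite XH_coaction_pure (lin_sw _ _ Cl).
  rewrite -[RHS](sw_counitl h ((bilin_pure H _).1 chi)).
  by apply: eq_sw => a b; rewrite (tliftE Cb).
Qed.

(** By [FOVC_ract_pure] the right action is given by [ract_of], and both sides
    equal \sum h_1 u_1 h'_1 ⊗ (h_2 u_2 h'_2 f(h'_3) ⊗ χ') on X = u ⊗ χ. *)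
Lemma XH_coaction_compat (r : XH g -> H -> XH g) h X h' :
    quantum_tangent_space g -> is_FOVC (@XH_lact k H g) r (@XH_L k H g) ->
  XH_coaction (r (XH_lact h X) h') =
  tens_ract r (tens_lact (@XH_lact k H g) (comul h) (XH_coaction X)) (comul h').
Proof.
move=> gq rF; have rl := XH_coaction_linear.
have [lb rb _ _ _ _ _] := FOVC_bimodule rF.
have Tl a b := tmap_linear (lin_mull a) (lb.2 b).
have Tr a b := tmap_linear (lin_mulr a) (rb.1 b).
have LA : linear (fun X => tens_lact (@XH_lact k H g) (comul h) (XH_coaction X)).
  apply: (sw_family (F := fun X a b =>
    tmap (fun c => a * c) (@XH_lact k H g b) (XH_coaction X))) => a b.
  exact: (lin_comp (Tl a b) rl).
move: X; apply: tens_eqfun => [||u chi].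
- exact: (lin_comp rl (lin_comp (rb.1 h') (lb.2 h))).
- apply: (sw_family (F := fun X a b => tmap (fun c => c * a) (r^~ b)
    (tens_lact (@XH_lact k H g) (comul h) (XH_coaction X)))) => a b.
  exact: (lin_comp (Tr a b) LA).
have [s chis] := quantum_tangent_rep gq chi.
pose G f (chi' : subsp g) (a b c d : H) : H ⊗ XH g :=
  (a * c) ⊗t ((b * hit (f : H°) d) ⊗t chi').
transitivity (tlift (fun f chi' =>
  sw (h * u) (fun a b => sw h' (G f chi' a b))) s).
  rewrite XH_lact_pure (FOVC_ract_pure _ _ rF chis) (lin_tlift _ _ rl).
  apply: eq_tlift => f chi'; rewrite XH_coaction_pure.
  have Cb := XH_coaction_bilin1 (H := H) chi'.
  rewrite (sw_mul _ _ Cb); apply: eq_sw => a b.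
  have Mb : bilin (fun c d : H => (a * c) ⊗t ((b * d) ⊗t chi' : XH g)).
    exact: (bilin_arg Cb (lin_mull a) (lin_mull b)).
  by rewrite (sw_hit _ (@fdual_linear _ _ f) Mb).
have GE a b : tlift (fun f chi' => sw h' (G f chi' a b)) s =
    sw h' (fun c d => (a * c) ⊗t r (b ⊗t chi) d).
  rewrite tlift_exchange; apply: eq_sw => c d.
  rewrite (FOVC_ract_pure _ _ rF chis).
  by rewrite (lin_tlift _ _ ((bilin_pure H (XH g)).2 _)).
rewrite tlift_exchange.
transitivity (sw (h * u) (fun a b =>
  sw h' (fun c d => (a * c) ⊗t r (b ⊗t chi) d))).
  by apply: eq_sw => a b; rewrite GE.
have Rb : bilin (fun a b => sw h' (fun c d => (a * c) ⊗t r (b ⊗t chi) d)).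
  split=> [b|a]; apply: (sw_family (F := _)) => c d.
    exact: (lin_comp ((bilin_pure _ _).1 _) (lin_mulr c)).
  apply: (lin_comp ((bilin_pure _ _).2 _)).
  exact: (lin_comp (rb.1 d) ((bilin_pure _ _).1 _)).
rewrite (sw_mul _ _ Rb).
transitivity (sw h' (fun c d => sw h (fun a b => sw u (fun u1 u2 =>
  ((a * u1) * c) ⊗t r ((b * u2) ⊗t chi) d)))).
  rewrite [RHS]sw_exchange; apply: eq_sw => a b.
  by rewrite sw_exchange.
apply: eq_sw => c d.
rewrite (lin_sw _ _ (Tr c d)); apply: eq_sw => a b.
rewrite XH_coaction_pure (lin_sw _ _ (Tl a b)) (lin_sw _ _ (Tr c d)).
apply: eq_sw => u1 u2; rewrite (tmapE (lin_mull a) (lb.2 b)).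
by rewrite (tmapE (lin_mulr c) (rb.1 d)) XH_lact_pure.
Qed.

Lemma XH_L_colinear :
  left_colinear (diag_coaction (@XH_coaction k H g) comul) comul
    (tlift (@XH_L k H g)).
Proof.
have rl := XH_coaction_linear; have cl := @lin_comul k H.
have il (V : lmodType k) : linear (idfun : V -> V) := @lin_id k V.
have Ll := tlift_linear (XH_L_bilin g).
have D1 (Y : H ⊗ H) := tlift_linear (@diag_bilin2 k H (XH g) H Y).
have dl : linear (diag_coaction (@XH_coaction k H g) comul).
  apply: tlift_linear; split=> [b|X c b b']; first exact: (lin_comp (D1 _) rl).
  apply: tlift_linear_fun => a x0.
  by rewrite cl (tlift_linear (diag_bilin1 H a x0)).
have Tl := tmap_linear (il H) Ll.
apply: tens_eqfun => [||X b]; [exact: (lin_comp cl Ll)|exact: (lin_comp Tl dl)|].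
rewrite (tliftE (XH_L_bilin g)) (diag_coactionE rl cl).
move: X; apply: tens_eqfun => [||h chi].
- exact: (lin_comp cl ((XH_L_bilin g).1 b)).
- exact: (lin_comp Tl (lin_comp (D1 _) rl)).
have Pb := bilin_pure H H.
have comulE a : comul a = sw a (@pure k H H) := esym (sw_comul a (il (H ⊗ H))).
rewrite XH_L_pure comulE (sw_mul _ _ Pb).
rewrite XH_coaction_pure (lin_sw _ _ (D1 _)) (lin_sw _ _ Tl).
apply: eq_sw => h1 h2.
rewrite (tliftE (@diag_bilin2 k H (XH g) H _)) (lin_tlift _ _ Tl).
have Mb : bilin (fun c d : H => (h1 * c) ⊗t (h2 * d)).
  exact: (bilin_arg Pb (lin_mull h1) (lin_mull h2)).
rewrite (sw_hit _ (@fdual_linear _ _ (val chi)) Mb); apply: eq_sw => b1 b2.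
by rewrite (tmapE (il H) Ll) (tliftE (XH_L_bilin g)) XH_L_pure.
Qed.

End CovarianceOfCalculus.

Theorem theorem3p3 (k : fieldType) (H : hopfAlgType k) (g : submodClosed H°)
  (g_aug : forall u, u \in g -> dual_aug u) (g_fin : finite_dim (subsp g)) :
  ((exists r : XH g -> H -> XH g, is_FOVC (@XH_lact k H g) r (@XH_L k H g))
     <-> quantum_tangent_space g)
  /\
  (forall r : XH g -> H -> XH g,
     is_FOVC (@XH_lact k H g) r (@XH_L k H g) ->
     is_left_covariant_FOVC (@XH_lact k H g) r (@XH_L k H g)
       (@XH_coaction k H g)).
Proof.
split=> [|r rF].
  split=> [[r rF]|]; first exact: FOVC_quantum_tangent g_aug g_fin rF.
  exact: quantum_tangent_FOVC.
have gq := FOVC_quantum_tangent g_aug g_fin rF.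
split; [exact: rF|split|exact: XH_L_colinear].
- exact: FOVC_bimodule rF.
- exact: XH_coaction_comodule.
- by move=> h X h'; exact: XH_coaction_compat.
Qed.
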